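(* Let $\Omega=\Omega(u,v)$ be a solution in $E^4$ of the Betchov-Da Rios equation $\Omega_v=\Omega_u\times\Omega_{uu}\times\Omega_{uuu}$ whose $u$-parameter curves are unit speed, with ED$^2$-frame field $\{T,E,D,N\}$ and associated functions $\kappa,\sigma,\tau$ (notation and standing assumptions as in the context). Then the mean curvature vector field of the soliton surface $S:\Omega=\Omega(u,v)$ is $$\vec H=\frac{1}{2(\kappa^2\tau)^2}\Big(B\,E+\kappa\tau\,C\,N\Big),$$ where $$B=-3\kappa^3\tau\sigma\sigma_u+\kappa^5\tau_u+2\kappa^4\tau\kappa_u-2\tau\kappa_u^3-\kappa^2\sigma^2(3\kappa\tau_u+5\tau\kappa_u)+2\kappa\kappa_u(\kappa_u\tau_u+2\tau\kappa_{uu})+\kappa^3\tau_{uuu}+\kappa^2(5\kappa_u\tau_{uu}+6\tau_u\kappa_{uu}+2\tau\kappa_{uuu}),$$ $$C=\kappa^2\sigma^2\tau-\kappa(4\kappa_u\tau_u+\kappa\tau_{uu})+\tau\big(\kappa^4-2\kappa_u^2-2\kappa\kappa_{uu}\big).$$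
   Context: $E^4$ is Euclidean 4-space with inner product $\langle\cdot,\cdot\rangle$, and $x\times y\times z$ is the usual alternating ternary vector product of $E^4$ (with a fixed sign convention, e.g. $\langle w,x\times y\times z\rangle=\det(w,x,y,z)$). Subscripts $u,v$ denote partial derivatives. All functions are assumed sufficiently smooth on an open domain of the $(u,v)$-plane. ED$^2$-frame field: for each $v$, the unit speed curve $u\mapsto\Omega(u,v)$ lies on an oriented hypersurface of $E^4$; $T=\Omega_u$ and $N(u,v)$ is the unit normal of the hypersurface at $\Omega(u,v)$. One is in the case where $\{N,T,\Omega_{uu}\}$ is linearly dependent; $E$ is the normalization of $\Omega_{uuu}-\langle\Omega_{uuu},N\rangle N-\langle\Omega_{uuu},T\rangle T$ (assumed nonzero), and $D=N\times T\times E$. Associated functions: $\kappa=\kappa_n=\langle T_u,N\rangle$, $\sigma=\kappa_g^2=\langle E_u,D\rangle$ (the superscript in $\kappa_g^2$ is an index, not a power), $\tau=\tau_g^1=\langle E_u,N\rangle$. The frame satisfies $T_u=\kappa N$, $E_u=\sigma D+\tau N$, $D_u=-\sigma E$, $N_u=-\kappa T-\tau E$. Standing assumption: $\kappa$ and $\tau$ are nowhere zero. The orthonormal normal frame of $S$ is $\{E,N\}$, and $\vec H=\tfrac12(\operatorname{tr}(A_E)E+\operatorname{tr}(A_N)N)$, where $A_E,A_N$ are the shape operators of $S$ with respect to the normal fields $E$ and $N$. *)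

(* Defs.v *)
From HB Require Import structures.
From mathcomp Require Import all_boot all_order all_algebra.
From mathcomp Require Import all_classical all_reals all_analysis.
Set Implicit Arguments.
Unset Strict Implicit.
Unset Printing Implicit Defensive.
Import Order.TTheory GRing.Theory Num.Theory.
Import numFieldNormedType.Exports.
Local Open Scope classical_set_scope.
Local Open Scope ring_scope.

Section EuclideanSpace.
Context {R : realType}.
Implicit Types w x y z : 'rV[R]_4.

Definition dot x y : R := \sum_(i < 4) x 0 i * y 0 i.

(* The library norm on row vectors is the sup norm, so the Euclidean norm has
   to be introduced separately; both induce the same topology. *)
Definition enorm x : R := Num.sqrt (dot x x).

Definition unitize x : 'rV[R]_4 := (enorm x)^-1 *: x.

Definition det4 w x y z : R :=
  \det (\matrix_(i < 4) nth 0 [:: w; x; y; z] i : 'M[R]_4).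

(* Coordinate i is det4 e_i x y z, so that dot w (vprod x y z) = det4 w x y z
   for every w. *)
Definition vprod x y z : 'rV[R]_4 :=
  \row_(i < 4) det4 (delta_mx 0 i) x y z.

End EuclideanSpace.

Section PartialDerivatives.
Context {R : realType} {V : normedModType R}.
Implicit Types f : R * R -> V.

Definition pu f : R * R -> V := fun p => 'D_(1, 0) f p.
Definition pv f : R * R -> V := fun p => 'D_(0, 1) f p.

(* Meant for open U; equality of mixed partials is not assumed. *)
Fixpoint Ck (k : nat) (U : set (R * R)) f : Prop :=
  {in U, continuous f} /\
  if k is k'.+1 then
    [/\ forall p, U p -> derivable f p (1, 0) /\ derivable f p (0, 1),
        Ck k' U (pu f) & Ck k' U (pv f)]
  else True.

End PartialDerivatives.

(* M is locally a regular level set of a C^1 function F, so its tangent space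
   at p is the kernel of the differential of F at p; the orientation is a
   continuous unit normal field nu along M. *)
Definition oriented_hypersurface {R : realType} (M : set 'rV[R]_4)
    (nu : 'rV[R]_4 -> 'rV[R]_4) : Prop :=
  {within M, continuous nu} /\
  forall p, M p -> exists F : 'rV[R]_4 -> R,
    [/\ \forall q \near p, differentiable F q /\
          (forall w, {for q, continuous (fun r => 'd F r w)}),
        exists w, 'd F p w != 0,
        \forall q \near p, M q <-> F q = 0,
        enorm (nu p) = 1
      & forall w, 'd F p w = 0 -> dot (nu p) w = 0].

Section FrameField.
Context {R : realType}.
Variables Omega N : R * R -> 'rV[R]_4.

Definition frameT : R * R -> 'rV[R]_4 := pu Omega.

Definition preE (p : R * R) : 'rV[R]_4 :=
  let w := pu (pu (pu Omega)) p in
  w - dot w (N p) *: N p - dot w (frameT p) *: frameT p.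

Definition frameE (p : R * R) : 'rV[R]_4 := unitize (preE p).

Definition frameD (p : R * R) : 'rV[R]_4 :=
  vprod (N p) (frameT p) (frameE p).

(* kappa is the normal curvature kappa_n, sigma the geodesic curvature
   kappa_g^2 (2 is an index) and tau the geodesic torsion tau_g^1. *)
Definition kappa (p : R * R) : R := dot (pu frameT p) (N p).
Definition sigma (p : R * R) : R := dot (pu frameE p) (frameD p).
Definition tau (p : R * R) : R := dot (pu frameE p) (N p).

(* The hypersurface may depend on the curve, i.e. on v. *)
Definition ED2_frame_field (U : set (R * R)) : Prop :=
  [/\ forall p, U p -> enorm (frameT p) = 1,
      forall v, exists M nu, oriented_hypersurface M nu /\
        forall u, U (u, v) ->
          M (Omega (u, v)) /\ N (u, v) = nu (Omega (u, v)),
      forall p, U p -> ~~ free [:: N p; frameT p; pu (pu Omega) p]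
    & forall p, U p -> preE p != 0].

Definition betchov_da_rios (U : set (R * R)) : Prop :=
  forall p, U p ->
    pv Omega p = vprod (pu Omega p) (pu (pu Omega) p) (pu (pu (pu Omega)) p).

End FrameField.

Section ParametrizedSurface.
Context {R : realType}.
Implicit Types (X xi : R * R -> 'rV[R]_4) (p : R * R).

Definition jacobian X p : 'M[R]_(2, 4) :=
  \matrix_(i < 2) nth 0 [:: pu X p; pv X p] i.

Definition first_form X p : 'M[R]_2 := jacobian X p *m (jacobian X p)^T.

(* Weingarten formula: the shape operator A_xi sends a tangent vector to minus
   the tangential component of the derivative of xi in its direction.  Row 0
   (resp. 1) of this matrix holds the coordinates of A_xi(X_u) (resp. A_xi(X_v))
   in the basis (X_u, X_v); the tangential component of w has coordinate row
   w *m J^T *m (J *m J^T)^-1, where J = jacobian X p.  Meaningful where X is an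
   immersion and xi is a normal field. *)
Definition shape_operator X xi p : 'M[R]_2 :=
  - (jacobian xi p *m (jacobian X p)^T *m invmx (first_form X p)).

(* (e1, e2) is meant to be an orthonormal frame of the normal bundle of X. *)
Definition mean_curvature_vector X e1 e2 p : 'rV[R]_4 :=
  2^-1 *: (\tr (shape_operator X e1 p) *: e1 p
           + \tr (shape_operator X e2 p) *: e2 p).

End ParametrizedSurface.

(* Main.v *)
Require Import Defs.
From HB Require Import structures.
From mathcomp Require Import all_boot all_order all_algebra.
From mathcomp Require Import all_classical all_reals all_analysis.
From mathcomp Require Import ring lra.
Set Implicit Arguments.
Unset Strict Implicit.
Unset Printing Implicit Defensive.
Import Order.TTheory GRing.Theory Num.Theory.
Import numFieldNormedType.Exports.
Local Open Scope classical_set_scope.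
Local Open Scope ring_scope.

(* In the frame, Omega_uu = k N and Omega_uuu = k_u N - k^2 T - k t E, so the
   evolution equation becomes Omega_v = f D with f = k^2 t.  The first form is
   therefore diag(1, f^2), and tr A_N = k - <N_v, D> / f,
   tr A_E = - <E_v, D> / f.  Commuting partial derivatives gives
   T_v = Omega_vu = f_u D - f s E; then T_uv = T_vu, i.e. (k N)_v = (T_v)_u,
   yields N_v = a D + b E with a = (f_uu - f s^2) / k and
   b = - (2 f_u s + f s_u) / k; finally the D-component of N_uv = N_vu is
   - k f_u - t <E_v, D> = a_u + b s.  Expanding f gives B and C. *)

(** * Functions of class C^k of two variables *)

Section SmoothFunctions.
Context {R : realType}.
Implicit Types (U : set (R * R)) (p d : R * R).

Lemma open_near_eq (T : Type) U (f g : R * R -> T) p :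
  open U -> (forall q, U q -> f q = g q) -> U p ->
  \forall q \near p, f q = g q.
Proof.
move=> oU fg Up; near=> q; apply: fg; near: q; exact: open_nbhs_nbhs.
Unshelve. all: by end_near. Qed.

(** Restricting to the line through p turns a directional derivative into an ordinary one, so that
    the one-variable chain rule and mean value theorem apply. *)
Lemma is_derive_line (W V : normedModType R) (f : W -> V) (p d : W) (l : V) :
  is_derive p d f l <-> is_derive (0 : R) 1 (fun t : R => f (t *: d + p)) l.
Proof.
have eqD : 'D_1 (fun t : R => f (t *: d + p)) 0 = 'D_d f p.
  rewrite /derive; set g1 := fun h => h^-1 *: _; set g2 := fun h => h^-1 *: _.
  suff -> : g1 = g2 by [].
  by rewrite funeqE /g1 /g2 => t /=; rewrite addr0 [_%:A]mulr1 scale0r add0r.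
split=> -[df <-]; split => //.
- exact: (iffLR (derivable1P f p d) df).
- exact: (iffRL (derivable1P f p d) df).
Qed.

Section Generic.
Context {V : normedModType R}.
Implicit Types f g : R * R -> V.

Lemma eq_pu U f g p : open U -> (forall q, U q -> f q = g q) -> U p ->
  pu f p = pu g p.
Proof. by move=> oU fg Up; apply: near_eq_derive; exact: open_near_eq fg Up. Qed.

Lemma eq_pv U f g p : open U -> (forall q, U q -> f q = g q) -> U p ->
  pv f p = pv g p.
Proof. by move=> oU fg Up; apply: near_eq_derive; exact: open_near_eq fg Up. Qed.

Lemma Ck_continuous k U f p : Ck k U f -> U p -> {for p, continuous f}.
Proof. by case: k => [|k] [cf _] Up; apply: cf; rewrite inE. Qed.

Lemma Ck_derivable k U f p : Ck k.+1 U f -> U p ->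
  derivable f p (1, 0) /\ derivable f p (0, 1).
Proof. by move=> [_ [df _ _]] /df. Qed.

Lemma Ck_pu k U f : Ck k.+1 U f -> Ck k U (pu f).
Proof. by move=> [_ []]. Qed.

Lemma Ck_pv k U f : Ck k.+1 U f -> Ck k U (pv f).
Proof. by move=> [_ []]. Qed.

Lemma CkW k l U f : (l <= k)%N -> Ck k U f -> Ck l U f.
Proof.
elim: k l f => [|k IHk] [|l] f //= lk [cf Cf]; split => //.
by have [df Cu Cv] := Cf; split => //; exact: IHk.
Qed.

(** The closed formula for the derivative of a sum, product, inverse or root holds on U only; this
    lemma carries an induction hypothesis about the formula over to the actual [pu] and [pv]. *)
Lemma eq_Ck k U f g : open U -> (forall p, U p -> f p = g p) ->
  Ck k U f -> Ck k U g.
Proof.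
move=> oU; elim: k f g => [|k IHk] f g fg [cf Cf]; split.
- move=> p; rewrite inE => Up; rewrite /continuous_at -(fg _ Up).
  apply: cvg_trans (cf p _); last by rewrite inE.
  by apply: near_eq_cvg; exact: open_near_eq Up.
- by [].
- move=> p; rewrite inE => Up; rewrite /continuous_at -(fg _ Up).
  apply: cvg_trans (cf p _); last by rewrite inE.
  by apply: near_eq_cvg; exact: open_near_eq Up.
have [df Cu Cv] := Cf; split.
- move=> p Up; have [du dv] := df _ Up.
  by split; [apply: near_eq_derivable du|apply: near_eq_derivable dv];
    exact: open_near_eq Up.
- by apply: IHk Cu => p Up; exact: eq_pu Up.
- by apply: IHk Cv => p Up; exact: eq_pv Up.
Qed.

End Generic.

Implicit Types f g : R * R -> R.

Lemma Ck_cst k U (c : R) : open U -> Ck k U (fun _ : R * R => c).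
Proof.
move=> oU; elim: k c => [|k IHk] c; split => //.
- by move=> p _; exact: cvg_cst.
- by move=> p _; exact: cvg_cst.
split.
- by move=> p _; split; exact: derivable_cst.
- by apply: eq_Ck (IHk 0) => // p _; rewrite /pu derive_cst.
- by apply: eq_Ck (IHk 0) => // p _; rewrite /pv derive_cst.
Qed.

Lemma CkD k U f g : open U -> Ck k U f -> Ck k U g ->
  Ck k U (fun p => f p + g p).
Proof.
move=> oU; elim: k f g => [|k IHk] f g Cf Cg; split => //.
- move=> p; rewrite inE => Up.
  by apply: continuousD; apply: Ck_continuous Up; eassumption.
- move=> p; rewrite inE => Up.
  by apply: continuousD; apply: Ck_continuous Up; eassumption.
split.
- move=> p Up; have [? ?] := Ck_derivable Cf Up; have [? ?] := Ck_derivable Cg Up.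
  by split; exact: derivableD.
- apply: eq_Ck (IHk _ _ (Ck_pu Cf) (Ck_pu Cg)) => // p Up.
  have [? _] := Ck_derivable Cf Up; have [? _] := Ck_derivable Cg Up.
  by rewrite /pu deriveD.
- apply: eq_Ck (IHk _ _ (Ck_pv Cf) (Ck_pv Cg)) => // p Up.
  have [_ ?] := Ck_derivable Cf Up; have [_ ?] := Ck_derivable Cg Up.
  by rewrite /pv deriveD.
Qed.

Lemma is_derive_add f g p d : derivable f p d -> derivable g p d ->
  is_derive p d (fun q => f q + g q) ('D_d f p + 'D_d g p).
Proof. by move=> df dg; split; [exact: derivableD|exact: deriveD]. Qed.

Lemma is_derive_mul f g p d : derivable f p d -> derivable g p d ->
  is_derive p d (fun q => f q * g q) (f p * 'D_d g p + g p * 'D_d f p).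
Proof.
move=> /derivableP df /derivableP dg.
have -> : (fun q => f q * g q) = f * g by rewrite mulrfctE.
exact: is_deriveM.
Qed.

Lemma CkM k U f g : open U -> Ck k U f -> Ck k U g ->
  Ck k U (fun p => f p * g p).
Proof.
move=> oU; elim: k f g => [|k IHk] f g Cf Cg; split => //.
- move=> p; rewrite inE => Up.
  by apply: continuousM; apply: Ck_continuous Up; eassumption.
- move=> p; rewrite inE => Up.
  by apply: continuousM; apply: Ck_continuous Up; eassumption.
(* The Leibniz formula contains f and g themselves next to their derivatives, so both are also
   needed at order k. *)
have [Cf' Cg'] := (CkW (leqnSn k) Cf, CkW (leqnSn k) Cg).
split.
- move=> p Up; have [fu fv] := Ck_derivable Cf Up.
  have [gu gv] := Ck_derivable Cg Up.
  by split; [have [] := is_derive_mul fu gu|have [] := is_derive_mul fv gv].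
- apply: eq_Ck (CkD oU (IHk _ _ Cf' (Ck_pu Cg)) (IHk _ _ Cg' (Ck_pu Cf))) => // p Up.
  have [df _] := Ck_derivable Cf Up; have [dg _] := Ck_derivable Cg Up.
  by rewrite /pu /pv; have [_ ->] := is_derive_mul df dg.
- apply: eq_Ck (CkD oU (IHk _ _ Cf' (Ck_pv Cg)) (IHk _ _ Cg' (Ck_pv Cf))) => // p Up.
  have [_ df] := Ck_derivable Cf Up; have [_ dg] := Ck_derivable Cg Up.
  by rewrite /pu /pv; have [_ ->] := is_derive_mul df dg.
Qed.

Lemma CkN k U f : open U -> Ck k U f -> Ck k U (fun p => - f p).
Proof.
move=> oU Cf; apply: eq_Ck (CkM oU (Ck_cst k (-1) oU) Cf) => // p _.
by rewrite mulN1r.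
Qed.

Lemma CkB k U f g : open U -> Ck k U f -> Ck k U g ->
  Ck k U (fun p => f p - g p).
Proof. by move=> oU Cf Cg; exact: CkD oU Cf (CkN oU Cg). Qed.

(** The square is spelled as a product of inverses so that [CkV] can pass its own induction
    hypothesis through [CkM]. *)
Lemma is_derive_inv f p d : f p != 0 -> derivable f p d ->
  is_derive p d (fun q => (f q)^-1) (- ((f p)^-1 * (f p)^-1) * 'D_d f p).
Proof.
move=> f0 df; split; first exact: derivableV.
by rewrite deriveV// expr2 invfM.
Qed.

Lemma CkV k U f : open U -> (forall p, U p -> f p != 0) -> Ck k U f ->
  Ck k U (fun p => (f p)^-1).
Proof.
move=> oU f0; elim: k => [|k IHk] Cf; split => //.
- move=> p; rewrite inE => Up.
  by apply: continuousV; [exact: f0|exact: Ck_continuous Cf Up].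
- move=> p; rewrite inE => Up.
  by apply: continuousV; [exact: f0|exact: Ck_continuous Cf Up].
have CV := IHk (CkW (leqnSn k) Cf).
split.
- move=> p Up; have [du dv] := Ck_derivable Cf Up.
  by split; [have [] := is_derive_inv (f0 _ Up) du
            |have [] := is_derive_inv (f0 _ Up) dv].
- apply: eq_Ck (CkM oU (CkN oU (CkM oU CV CV)) (Ck_pu Cf)) => // p Up.
  have [du _] := Ck_derivable Cf Up.
  by rewrite /pu; have [_ ->] := is_derive_inv (f0 _ Up) du.
- apply: eq_Ck (CkM oU (CkN oU (CkM oU CV CV)) (Ck_pv Cf)) => // p Up.
  have [_ dv] := Ck_derivable Cf Up.
  by rewrite /pv; have [_ ->] := is_derive_inv (f0 _ Up) dv.
Qed.

Lemma is_derive_sqrt f p d : 0 < f p -> derivable f p d ->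
  is_derive p d (fun q => Num.sqrt (f q)) ((2 * Num.sqrt (f p))^-1 * 'D_d f p).
Proof.
move=> f0 /derivableP /is_derive_line dh; apply/is_derive_line.
set h := (fun t : R => _) in dh.
have h0 : h 0 = f p by rewrite /h scale0r add0r.
have ds : is_derive (h 0) 1 Num.sqrt (2 * Num.sqrt (h 0))^-1.
  by apply: is_derive1_sqrt; rewrite h0.
by have := is_derive1_comp ds dh; rewrite h0.
Qed.

Lemma Ck_sqrt k U f : open U -> (forall p, U p -> 0 < f p) -> Ck k U f ->
  Ck k U (fun p => Num.sqrt (f p)).
Proof.
move=> oU f0; elim: k => [|k IHk] Cf.
  split => // p; rewrite inE => Up.
  by apply: continuous_comp (Ck_continuous Cf Up) _; exact: sqrt_continuous.
have CS := IHk (CkW (leqnSn k) Cf).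
(* The root reappears in its own derivative, where the induction hypothesis covers it; positivity of
   f makes the denominator nonzero. *)
have CV : Ck k U (fun p => (2 * Num.sqrt (f p))^-1).
  apply: CkV => //; last by apply: CkM => //; exact: Ck_cst.
  by move=> p Up; rewrite mulf_neq0 // gt_eqF // sqrtr_gt0 f0.
split => [p|].
  rewrite inE => Up; apply: continuous_comp (Ck_continuous Cf Up) _.
  exact: sqrt_continuous.
split.
- by move=> p Up; have [du dv] := Ck_derivable Cf Up; split;
    [have [] := is_derive_sqrt (f0 _ Up) du|have [] := is_derive_sqrt (f0 _ Up) dv].
- apply: eq_Ck (CkM oU CV (Ck_pu Cf)) => // p Up.
  by have [du _] := Ck_derivable Cf Up; have [] := is_derive_sqrt (f0 _ Up) du.
- apply: eq_Ck (CkM oU CV (Ck_pv Cf)) => // p Up.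
  by have [_ dv] := Ck_derivable Cf Up; have [] := is_derive_sqrt (f0 _ Up) dv.
Qed.

(** Derivability on the closed segment supplies the continuity that [MVT] asks for, and the closed
    range of c matches the hypotheses of [mixed_difference]. *)
Lemma mean_value (f df : R -> R) (a b : R) : a < b ->
  (forall x : R, x \in `[a, b] -> is_derive x 1 f (df x)) ->
  exists2 c, c \in `[a, b] & f b - f a = df c * (b - a).
Proof.
move=> ab dfE.
have dfE' x : x \in `]a, b[ -> is_derive x 1 f (df x).
  by move=> xab; apply: dfE; exact: subset_itv_oo_cc xab.
have [|c cab ->] := MVT ab dfE'.
  by apply: derivable_within_continuous => x /dfE[].
by exists c => //; exact: subset_itv_oo_cc cab.
Qed.

(** The mean value theorem is applied in x to the difference of F between the heights b + h and b,
    and then in y to [Fx] at the abscissa so found. *)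
Lemma mixed_difference (F Fx Fxy : R -> R -> R) (a b h : R) : 0 < h ->
  {in `[a, a + h] & `[b, b + h],
    forall x y : R, is_derive x 1 (fun x => F x y) (Fx x y)} ->
  {in `[a, a + h] & `[b, b + h], forall x y : R, is_derive y 1 (Fx x) (Fxy x y)} ->
  exists2 q : R * R, q.1 \in `[a, a + h] /\ q.2 \in `[b, b + h] &
    F (a + h) (b + h) - F (a + h) b - (F a (b + h) - F a b)
      = h * h * Fxy q.1 q.2.
Proof.
move=> h0 dF dFx.
have ltDh (c : R) : c < c + h by rewrite ltrDl.
have bl : b \in `[b, b + h] by rewrite in_itv /= lexx ltW.
have br : b + h \in `[b, b + h] by rewrite in_itv /= lexx ltW.
have dG x : x \in `[a, a + h] ->
    is_derive x 1 (fun x => F x (b + h) - F x b) (Fx x (b + h) - Fx x b).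
  by move=> xa; have := dF _ _ xa br; have := dF _ _ xa bl => ? ?; exact: is_deriveB.
have [x xa Gx] := @mean_value (fun x => F x (b + h) - F x b)
  (fun x => Fx x (b + h) - Fx x b) _ _ (ltDh a) dG.
have [y ya Gy] := @mean_value (Fx x) (Fxy x) _ _ (ltDh b)
  (fun y ya => dFx _ y xa ya).
exists (x, y); first by split.
move: Gx; rewrite Gy /= => Gx.
have -> : F (a + h) (b + h) - F (a + h) b - (F a (b + h) - F a b) =
  Fxy x y * (b + h - b) * (a + h - a) by rewrite -Gx.
by ring.
Qed.

Lemma is_derive_fst f (x y l : R) :
  is_derive (x, y) (1, 0) f l <-> is_derive x 1 (fun t => f (t, y)) l.
Proof.
have lineE : (fun t : R => f (t *: (1, 0) + (x, y))) =
    (fun t : R => f (t *: 1 + x, y)).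
  apply/funext => t; congr f; congr (_, _).
  by rewrite /= scaler0 add0r.
have h := is_derive_line f (x, y) (1, 0) l; rewrite lineE in h.
exact: iff_trans h (iff_sym (is_derive_line (fun t => f (t, y)) x 1 l)).
Qed.

Lemma is_derive_snd f (x y l : R) :
  is_derive (x, y) (0, 1) f l <-> is_derive y 1 (fun t => f (x, t)) l.
Proof.
have lineE : (fun t : R => f (t *: (0, 1) + (x, y))) =
    (fun t : R => f (x, t *: 1 + y)).
  apply/funext => t; congr f; congr (_, _).
  by rewrite /= scaler0 add0r.
have h := is_derive_line f (x, y) (0, 1) l; rewrite lineE in h.
exact: iff_trans h (iff_sym (is_derive_line (fun t => f (x, t)) y 1 l)).
Qed.

(** Schwarz's theorem: the second difference of f over a small square is h * h times either mixed
    partial, each taken at some point of the square, and both partials are continuous at p. *)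
Lemma pu_pv U f p : open U -> Ck 2 U f -> U p -> pu (pv f) p = pv (pu f) p.
Proof.
move=> oU Cf Up.
have cuv := Ck_continuous (Ck_pu (Ck_pv Cf)) Up.
have cvu := Ck_continuous (Ck_pv (Ck_pu Cf)) Up.
apply/eqP; rewrite -subr_eq0 -normr_le0; apply/ler_addgt0Pl => e e0.
rewrite addr0.
have e20 : 0 < e / 2 by rewrite divr_gt0.
move/cvgrPdist_lt/(_ _ e20) : cuv => cuv.
move/cvgrPdist_lt/(_ _ e20) : cvu => cvu.
have : \forall q \near p, [/\ U q, `|pu (pv f) p - pu (pv f) q| < e / 2
    & `|pv (pu f) p - pv (pu f) q| < e / 2].
  have nU : nbhs p U by exact: open_nbhs_nbhs.
  exact: filterS3 (fun q Uq h1 h2 => And3 Uq h1 h2) nU cuv cvu.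
move=> /nbhs_ballP[r /= r0 br].
case: p Up cuv cvu br => a b Up _ _ br.
(* Half the radius keeps the whole closed square inside the open ball. *)
pose h := r / 2; have h0 : 0 < h by rewrite divr_gt0.
have inr : {in `[a, a + h] & `[b, b + h], forall x y : R, ball (a, b) r (x, y)}.
  move=> x y; rewrite !in_itv /= => /andP[ax xa] /andP[b_y yb].
  have hr : h < r by rewrite /h ltr_pdivrMr// ltr_pMr// ltr1n.
  by split; rewrite /ball /= distrC ger0_norm ?subr_ge0//; lra.
have [q1 [q1a q1b] E1] : exists2 q : R * R,
    q.1 \in `[a, a + h] /\ q.2 \in `[b, b + h] &
    f (a + h, b + h) - f (a + h, b) - (f (a, b + h) - f (a, b))
      = h * h * pv (pu f) q.
  have [x y xa yb|x y xa yb|q qab E] := @mixed_difference (fun x y => f (x, y))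
    (fun x y => pu f (x, y)) (fun x y => pv (pu f) (x, y)) a b h h0.
  - have [Uxy _ _] := br _ (inr _ _ xa yb); apply/is_derive_fst.
    by apply: derivableP; have [] := Ck_derivable Cf Uxy.
  - have [Uxy _ _] := br _ (inr _ _ xa yb); apply/is_derive_snd.
    by apply: derivableP; have [] := Ck_derivable (Ck_pu Cf) Uxy.
  by case: q qab E => x y qab E; exists (x, y); [exact: qab|exact: E].
(* The same square with the variables exchanged: v is now the first variable of
   [mixed_difference]. *)
have [q2 [q2a q2b] E2] : exists2 q : R * R,
    q.1 \in `[a, a + h] /\ q.2 \in `[b, b + h] &
    f (a + h, b + h) - f (a, b + h) - (f (a + h, b) - f (a, b))
      = h * h * pu (pv f) q.
  have [y x yb xa|y x yb xa|[y x] [yb xa] E] := @mixed_difference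
    (fun y x => f (x, y)) (fun y x => pv f (x, y)) (fun y x => pu (pv f) (x, y)) b a h h0.
  - have [Uxy _ _] := br _ (inr _ _ xa yb); apply/is_derive_snd.
    by apply: derivableP; have [] := Ck_derivable Cf Uxy.
  - have [Uxy _ _] := br _ (inr _ _ xa yb); apply/is_derive_fst.
    by apply: derivableP; have [] := Ck_derivable (Ck_pv Cf) Uxy.
  by exists (x, y).
case: q1 q1a q1b E1 => x1 y1 q1a q1b E1.
case: q2 q2a q2b E2 => x2 y2 q2a q2b E2.
have [_ _ c1] := br _ (inr _ _ q1a q1b); have [_ c2 _] := br _ (inr _ _ q2a q2b).
move: E1 E2 c1 c2.
move: (f _) (f _) (f _) (f _) => f1 f2 f3 f4.
move: (pv _ _) (pv _ _) (pu _ _) (pu _ _) => g1 g2 g3 g4 E1 E2.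
(* Both values times h * h equal one second difference, so the two mixed partials agree at two
   possibly different points of the square; what remains is the triangle inequality. *)
have -> : g2 = g4.
  have hh : h * h != 0 by rewrite mulf_neq0// gt_eqF.
  by apply: (mulfI hh); rewrite -E1 -E2; ring.
rewrite !ltr_norml => /andP[? ?] /andP[? ?].
by rewrite ler_norml; apply/andP; split; lra.
Qed.

End SmoothFunctions.

(** * Dot and vector products in coordinates *)

Section EuclideanAlgebra.
Context {R : realType}.
Implicit Types (a c : R) (w x y z : 'rV[R]_4).

(* Indexing coordinates by nat lets the ordinals produced by Laplace expansion
   compute to literals. *)
Definition coord4 x (n : nat) : R := x 0 (inord n).

Lemma coord4E x (i : 'I_4) : x 0 i = coord4 x i.
Proof. by rewrite /coord4 inord_val. Qed.

Lemma coord4P x y : (forall n, (n < 4)%N -> coord4 x n = coord4 y n) -> x = y.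
Proof. by move=> xy; apply/rowP => i; rewrite !coord4E xy. Qed.

Lemma coord4D x y n : coord4 (x + y) n = coord4 x n + coord4 y n.
Proof. by rewrite /coord4 mxE. Qed.

Lemma coord4N x n : coord4 (- x) n = - coord4 x n.
Proof. by rewrite /coord4 mxE. Qed.

Lemma coord4Z a x n : coord4 (a *: x) n = a * coord4 x n.
Proof. by rewrite /coord4 mxE. Qed.

Lemma dot_coord4 x y : dot x y = coord4 x 0 * coord4 y 0 + coord4 x 1 * coord4 y 1
  + coord4 x 2 * coord4 y 2 + coord4 x 3 * coord4 y 3.
Proof. by rewrite /dot !big_ord_recr big_ord0 /= !coord4E /= add0r. Qed.

Lemma dotC x y : dot x y = dot y x.
Proof. by rewrite !dot_coord4; ring. Qed.

Lemma dotDl x y z : dot (x + y) z = dot x z + dot y z.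
Proof. by rewrite !dot_coord4 !coord4D; ring. Qed.

Lemma dotNl x z : dot (- x) z = - dot x z.
Proof. by rewrite !dot_coord4 !coord4N; ring. Qed.

Lemma dotZl a x z : dot (a *: x) z = a * dot x z.
Proof. by rewrite !dot_coord4 !coord4Z; ring. Qed.

Lemma dotDr z x y : dot z (x + y) = dot z x + dot z y.
Proof. by rewrite !(dotC z) dotDl. Qed.

Lemma dotNr z x : dot z (- x) = - dot z x.
Proof. by rewrite !(dotC z) dotNl. Qed.

Lemma dotZr a z x : dot z (a *: x) = a * dot z x.
Proof. by rewrite !(dotC z) dotZl. Qed.

Lemma dot0l z : dot 0 z = 0.
Proof. by rewrite -(scale0r z) dotZl mul0r. Qed.

Definition dotE := (dotDl, dotDr, dotNl, dotNr, dotZl, dotZr).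

Lemma dot_ge0 x : 0 <= dot x x.
Proof. by apply: sumr_ge0 => i _; rewrite -expr2 sqr_ge0. Qed.

Lemma dot_eq0 x : (dot x x == 0) = (x == 0).
Proof.
apply/eqP/eqP => [|->]; last exact: dot0l.
move=> /eqP; rewrite psumr_eq0 => [/allP xx0|i _]; last by rewrite -expr2 sqr_ge0.
apply/rowP => i; rewrite mxE; apply/eqP; rewrite -sqrf_eq0 expr2.
by apply: (implyP (xx0 i _)) => //; exact: mem_index_enum.
Qed.

Lemma enorm_sqr x : enorm x * enorm x = dot x x.
Proof. by rewrite -expr2 sqr_sqrtr// dot_ge0. Qed.

Lemma enorm_gt0 x : (0 < enorm x) = (x != 0).
Proof. by rewrite sqrtr_gt0 lt0r dot_eq0 dot_ge0 andbT. Qed.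

Lemma enorm1_dot x : enorm x = 1 -> dot x x = 1.
Proof. by move=> x1; rewrite -enorm_sqr x1 mulr1. Qed.

Lemma det4_coord4 w x y z : det4 w x y z =
  coord4 w 0 * (coord4 x 1 * (coord4 y 2 * coord4 z 3 - coord4 y 3 * coord4 z 2)
    - coord4 x 2 * (coord4 y 1 * coord4 z 3 - coord4 y 3 * coord4 z 1)
    + coord4 x 3 * (coord4 y 1 * coord4 z 2 - coord4 y 2 * coord4 z 1))
  - coord4 w 1 * (coord4 x 0 * (coord4 y 2 * coord4 z 3 - coord4 y 3 * coord4 z 2)
    - coord4 x 2 * (coord4 y 0 * coord4 z 3 - coord4 y 3 * coord4 z 0)
    + coord4 x 3 * (coord4 y 0 * coord4 z 2 - coord4 y 2 * coord4 z 0))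
  + coord4 w 2 * (coord4 x 0 * (coord4 y 1 * coord4 z 3 - coord4 y 3 * coord4 z 1)
    - coord4 x 1 * (coord4 y 0 * coord4 z 3 - coord4 y 3 * coord4 z 0)
    + coord4 x 3 * (coord4 y 0 * coord4 z 1 - coord4 y 1 * coord4 z 0))
  - coord4 w 3 * (coord4 x 0 * (coord4 y 1 * coord4 z 2 - coord4 y 2 * coord4 z 1)
    - coord4 x 1 * (coord4 y 0 * coord4 z 2 - coord4 y 2 * coord4 z 0)
    + coord4 x 2 * (coord4 y 0 * coord4 z 1 - coord4 y 1 * coord4 z 0)).
Proof.
rewrite /det4 (expand_det_row _ ord0) !big_ord_recl big_ord0 /cofactor.
rewrite !(expand_det_row _ ord0) !big_ord_recl !big_ord0 /cofactor.
rewrite !(expand_det_row _ ord0) !big_ord_recl !big_ord0 /cofactor !det_mx11.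
(* Unfolding [bump] evaluates the nested lifts left by the three Laplace expansions to literal
   indices. *)
rewrite !mxE /= !coord4E /= /bump /= !add0n !addn0 /=.
by ring.
Qed.

End EuclideanAlgebra.

(** * Vector product, orthonormal expansion and traces of shape operators *)

Section VectorProduct.
Context {R : realType}.
Implicit Types (a b c d e : R) (w x y z : 'rV[R]_4).

Lemma coord4_delta n m : (n < 4)%N -> (m < 4)%N ->
  coord4 (delta_mx 0 (inord n) : 'rV[R]_4) m = (m == n)%:R.
Proof. by move=> n4 m4; rewrite /coord4 mxE eqxx -val_eqE /= !inordK. Qed.

(** With the signed cofactors explicit, identities about [vprod] become polynomial identities in
    coordinates, within reach of [ring]. *)
Lemma vprod_coord4 x y z :
  [/\ coord4 (vprod x y z) 0 =
        coord4 x 1 * (coord4 y 2 * coord4 z 3 - coord4 y 3 * coord4 z 2)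
        - coord4 x 2 * (coord4 y 1 * coord4 z 3 - coord4 y 3 * coord4 z 1)
        + coord4 x 3 * (coord4 y 1 * coord4 z 2 - coord4 y 2 * coord4 z 1),
      coord4 (vprod x y z) 1 = -
        (coord4 x 0 * (coord4 y 2 * coord4 z 3 - coord4 y 3 * coord4 z 2)
        - coord4 x 2 * (coord4 y 0 * coord4 z 3 - coord4 y 3 * coord4 z 0)
        + coord4 x 3 * (coord4 y 0 * coord4 z 2 - coord4 y 2 * coord4 z 0)),
      coord4 (vprod x y z) 2 =
        coord4 x 0 * (coord4 y 1 * coord4 z 3 - coord4 y 3 * coord4 z 1)
        - coord4 x 1 * (coord4 y 0 * coord4 z 3 - coord4 y 3 * coord4 z 0)
        + coord4 x 3 * (coord4 y 0 * coord4 z 1 - coord4 y 1 * coord4 z 0)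
    & coord4 (vprod x y z) 3 = -
        (coord4 x 0 * (coord4 y 1 * coord4 z 2 - coord4 y 2 * coord4 z 1)
        - coord4 x 1 * (coord4 y 0 * coord4 z 2 - coord4 y 2 * coord4 z 0)
        + coord4 x 2 * (coord4 y 0 * coord4 z 1 - coord4 y 1 * coord4 z 0))].
Proof.
have vE n : coord4 (vprod x y z) n = det4 (delta_mx 0 (inord n)) x y z.
  by rewrite /coord4 mxE.
by split; rewrite vE det4_coord4 !coord4_delta //= !mul0r mul1r
  ?subr0 ?add0r ?addr0 ?sub0r.
Qed.

Lemma dot_vprod1 x y z : dot x (vprod x y z) = 0.
Proof.
by have [v0 v1 v2 v3] := vprod_coord4 x y z; rewrite dot_coord4 v0 v1 v2 v3; ring.
Qed.

Lemma dot_vprod2 x y z : dot y (vprod x y z) = 0.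
Proof.
by have [v0 v1 v2 v3] := vprod_coord4 x y z; rewrite dot_coord4 v0 v1 v2 v3; ring.
Qed.

Lemma dot_vprod3 x y z : dot z (vprod x y z) = 0.
Proof.
by have [v0 v1 v2 v3] := vprod_coord4 x y z; rewrite dot_coord4 v0 v1 v2 v3; ring.
Qed.

(** The squared length of the product is the Gram determinant of its three factors. *)
Lemma dot_vprod_orthonormal x y z :
  dot x x = 1 -> dot y y = 1 -> dot z z = 1 ->
  dot x y = 0 -> dot x z = 0 -> dot y z = 0 ->
  dot (vprod x y z) (vprod x y z) = 1.
Proof.
move=> xx yy zz xy xz yz.
have gram : dot (vprod x y z) (vprod x y z) =
    dot x x * (dot y y * dot z z - dot y z * dot y z)
    - dot x y * (dot x y * dot z z - dot y z * dot x z)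
    + dot x z * (dot x y * dot y z - dot y y * dot x z).
  have [v0 v1 v2 v3] := vprod_coord4 x y z.
  by rewrite (dot_coord4 (vprod _ _ _)) v0 v1 v2 v3 !dot_coord4; ring.
by rewrite gram xx yy zz xy xz yz; ring.
Qed.

(** The product is multilinear and alternating, so only the z-part of the last factor survives;
    exchanging x and y costs the sign. With x, y, z equal to T, N, E the right side becomes a
    multiple of D = N x T x E. *)
Lemma vprod_triangular a b c d e x y z :
  vprod x (a *: y) (b *: y + c *: (d *: x + e *: z)) =
    (- (a * c * e)) *: vprod y x z.
Proof.
have [v0 v1 v2 v3] := vprod_coord4 x (a *: y) (b *: y + c *: (d *: x + e *: z)).
have [w0 w1 w2 w3] := vprod_coord4 y x z.
apply: coord4P => -[|[|[|[|//]]]] _;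
  by rewrite coord4Z ?v0 ?v1 ?v2 ?v3 ?w0 ?w1 ?w2 ?w3 !(coord4D, coord4Z); ring.
Qed.

(** For the square matrix M with rows e0, ..., e3, orthonormality says that M times its transpose is
    1; the product in the other order is then 1 as well, and w is multiplied by it. *)
Lemma orthonormal_expansion (e0 e1 e2 e3 w : 'rV[R]_4) :
  dot e0 e0 = 1 -> dot e1 e1 = 1 -> dot e2 e2 = 1 -> dot e3 e3 = 1 ->
  dot e0 e1 = 0 -> dot e0 e2 = 0 -> dot e0 e3 = 0 ->
  dot e1 e2 = 0 -> dot e1 e3 = 0 -> dot e2 e3 = 0 ->
  w = dot w e0 *: e0 + dot w e1 *: e1 + dot w e2 *: e2 + dot w e3 *: e3.
Proof.
move=> e00 e11 e22 e33 e01 e02 e03 e12 e13 e23.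
pose M : 'M[R]_4 := \matrix_(i < 4) nth 0 [:: e0; e1; e2; e3] i.
have dotM (u : 'rV[R]_4) i : (u *m M^T) 0 i = dot u (nth 0 [:: e0; e1; e2; e3] i).
  by rewrite mxE /dot; apply: eq_bigr => j _; rewrite !mxE.
have MMT : M *m M^T = 1%:M.
  apply/matrixP => i j.
  have -> : (M *m M^T) i j = (row i M *m M^T) 0 j by rewrite -row_mul [RHS]mxE.
  rewrite dotM rowK !mxE.
  by case: i => -[|[|[|[|//]]]] i4; case: j => -[|[|[|[|//]]]] j4 /=;
    rewrite // dotC.
rewrite -{1}[w]mulmx1 -(mulmx1C MMT) mulmxA mulmx_sum_row.
by rewrite !big_ord_recr big_ord0 /= add0r !dotM !rowK.
Qed.

(** Orthogonal parameter directions make the first form diagonal, so its inverse is explicit. *)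
Lemma orthogonal_trace_shape (X xi : R * R -> 'rV[R]_4) (p : R * R) (e g : R) :
  dot (pu X p) (pu X p) = e -> dot (pv X p) (pv X p) = g ->
  e != 0 -> g != 0 -> dot (pu X p) (pv X p) = 0 ->
  \tr (shape_operator X xi p) =
    - (dot (pu xi p) (pu X p) / e + dot (pv xi p) (pv X p) / g).
Proof.
move=> <- <- E0 G0 F0.
have entry (Y Z : R * R -> 'rV[R]_4) i j :
    (Defs.jacobian Y p *m (Defs.jacobian Z p)^T) i j =
    dot (nth 0 [:: pu Y p; pv Y p] i) (nth 0 [:: pu Z p; pv Z p] j).
  by rewrite mxE /dot; apply: eq_bigr => k _; rewrite !mxE.
pose I : 'M[R]_2 := diag_mx (\row_j nth 0
  [:: (dot (pu X p) (pu X p))^-1; (dot (pv X p) (pv X p))^-1] j).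
have FI : first_form X p *m I = 1%:M.
  apply/matrixP => i j; rewrite mul_mx_diag mxE entry [X in _ * X]mxE [RHS]mxE.
  rewrite -val_eqE.
  case: i => -[|[|//]] i2; case: j => -[|[|//]] j2 /=.
  - by rewrite (mulfV E0).
  - rewrite F0; exact: mul0r.
  - rewrite dotC F0; exact: mul0r.
  - by rewrite (mulfV G0).
have invF : invmx (first_form X p) = I.
  have [uF _] := mulmx1_unit FI.
  by rewrite -[RHS]mul1mx -(mulVmx uF) -mulmxA FI mulmx1.
rewrite /shape_operator raddfN /= invF mul_mx_diag /mxtrace; congr (- _).
rewrite !big_ord_recr big_ord0 /= add0r.
by congr (_ + _); rewrite mxE entry [X in _ * X]mxE.
Qed.

Lemma mean_curvature_vector_trace (X e1 e2 : R * R -> 'rV[R]_4) p (h1 h2 : R) :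
  \tr (shape_operator X e1 p) = h1 -> \tr (shape_operator X e2 p) = h2 ->
  mean_curvature_vector X e1 e2 p = 2^-1 *: (h1 *: e1 p + h2 *: e2 p).
Proof. by move=> <- <-. Qed.

End VectorProduct.

(** * Smooth vector fields *)

Section VectorCalculus.
Context {R : realType}.
Implicit Types (U : set (R * R)) (p d : R * R) (h : R * R -> R)
  (x y z : R * R -> 'rV[R]_4).

(** Regularity is kept coordinatewise so that the scalar closure rules for [Ck] apply directly to
    dot and vector products. *)
Definition smooth k U x := forall n, Ck k U (fun p => coord4 (x p) n).

Lemma derivable_coord4 x p d : derivable x p d <->
  forall n, derivable (fun q => coord4 (x q) n) p d.
Proof.
split=> [/derivable_mxP dx n|dx]; first exact: dx.
apply/derivable_mxP => i j; rewrite (ord1 i).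
apply: near_eq_derivable (dx j); near=> q; exact: esym (coord4E _ _).
Unshelve. all: by end_near. Qed.

Lemma derive_coord4 x p d n : derivable x p d ->
  coord4 ('D_d x p) n = 'D_d (fun q => coord4 (x q) n) p.
Proof. by move=> dx; rewrite /coord4 derive_mx// mxE. Qed.

Lemma smooth_derivable k U x p : smooth k.+1 U x -> U p ->
  derivable x p (1, 0) /\ derivable x p (0, 1).
Proof.
move=> sx Up; split; apply/derivable_coord4 => n.
- exact: (Ck_derivable (sx n) Up).1.
- exact: (Ck_derivable (sx n) Up).2.
Qed.

Lemma smooth_pu k U x : open U -> smooth k.+1 U x -> smooth k U (pu x).
Proof.
move=> oU sx n; apply: eq_Ck (Ck_pu (sx n)) => // p Up.
have [dx _] := smooth_derivable sx Up.
exact: esym (derive_coord4 n dx).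
Qed.

Lemma smooth_pv k U x : open U -> smooth k.+1 U x -> smooth k U (pv x).
Proof.
move=> oU sx n; apply: eq_Ck (Ck_pv (sx n)) => // p Up.
have [_ dx] := smooth_derivable sx Up.
exact: esym (derive_coord4 n dx).
Qed.

Lemma Ck_smooth k U x : open U -> Ck k U x -> smooth k U x.
Proof.
move=> oU; elim: k x => [|k IHk] x Cx n.
  split => // p; rewrite inE => Up.
  exact: continuous_comp (Ck_continuous Cx Up) (@coord_continuous _ _ _ _ _ _).
split.
  move=> p; rewrite inE => Up.
  exact: continuous_comp (Ck_continuous Cx Up) (@coord_continuous _ _ _ _ _ _).
split.
- move=> p Up; have [du dv] := Ck_derivable Cx Up.
  by split; [exact: (derivable_coord4 x p _).1 du n
            |exact: (derivable_coord4 x p _).1 dv n].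
- apply: eq_Ck (IHk _ (Ck_pu Cx) n) => // p Up.
  have [du _] := Ck_derivable Cx Up.
  exact: derive_coord4 n du.
- apply: eq_Ck (IHk _ (Ck_pv Cx) n) => // p Up.
  have [_ dv] := Ck_derivable Cx Up.
  exact: derive_coord4 n dv.
Qed.

Lemma smoothW k l U x : (l <= k)%N -> smooth k U x -> smooth l U x.
Proof. by move=> lk sx n; exact: CkW lk (sx n). Qed.

Lemma Ck_dot k U x y : open U -> smooth k U x -> smooth k U y ->
  Ck k U (fun p => dot (x p) (y p)).
Proof.
move=> oU sx sy.
have sM n := CkM oU (sx n) (sy n).
apply: eq_Ck (CkD oU (CkD oU (CkD oU (sM 0) (sM 1)) (sM 2)) (sM 3)) => // p _.
by rewrite dot_coord4.
Qed.

Lemma smoothZ k U h x : open U -> Ck k U h -> smooth k U x ->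
  smooth k U (fun p => h p *: x p).
Proof.
move=> oU Ch sx n; apply: eq_Ck (CkM oU Ch (sx n)) => // p _.
by rewrite coord4Z.
Qed.

Lemma smoothB k U x y : open U -> smooth k U x -> smooth k U y ->
  smooth k U (fun p => x p - y p).
Proof.
move=> oU sx sy n; apply: eq_Ck (CkB oU (sx n) (sy n)) => // p _.
by rewrite coord4D coord4N.
Qed.

Lemma smooth_vprod k U x y z : open U ->
  smooth k U x -> smooth k U y -> smooth k U z ->
  smooth k U (fun p => vprod (x p) (y p) (z p)).
Proof.
move=> oU sx sy sz.
(* [s2] treats the 2 by 2 minors of y and z, [s3] the 3 by 3 minors, which are the coordinates up to
   sign. *)
have s2 m n := CkB oU (CkM oU (sy m) (sz n)) (CkM oU (sy n) (sz m)).
have s3 l m n := CkD oU (CkB oU (CkM oU (sx l) (s2 m n)) (CkM oU (sx m) (s2 l n)))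
  (CkM oU (sx n) (s2 l m)).
have s n : (n < 4)%N -> Ck k U (fun p => coord4 (vprod (x p) (y p) (z p)) n).
  move: n => -[|[|[|[|//]]]] _.
  - apply: eq_Ck (s3 1 2 3)%N => // p _.
    by have [-> _ _ _] := vprod_coord4 (x p) (y p) (z p).
  - apply: eq_Ck (CkN oU (s3 0 2 3)%N) => // p _.
    by have [_ -> _ _] := vprod_coord4 (x p) (y p) (z p).
  - apply: eq_Ck (s3 0 1 3)%N => // p _.
    by have [_ _ -> _] := vprod_coord4 (x p) (y p) (z p).
  - apply: eq_Ck (CkN oU (s3 0 1 2)%N) => // p _.
    by have [_ _ _ ->] := vprod_coord4 (x p) (y p) (z p).
(* [coord4] reads position [inord n], so an arbitrary n reduces to an index below 4. *)
move=> n; apply: eq_Ck (s (inord n : 'I_4) (ltn_ord _)) => // p _.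
by rewrite -coord4E.
Qed.

Lemma is_derive_dot x y p d : derivable x p d -> derivable y p d ->
  is_derive p d (fun q => dot (x q) (y q))
    (dot ('D_d x p) (y p) + dot (x p) ('D_d y p)).
Proof.
move=> dx dy.
have dM n := is_derive_mul ((derivable_coord4 x p d).1 dx n)
  ((derivable_coord4 y p d).1 dy n).
have dMn n := @ex_derive _ _ _ _ _ _ _ (dM n).
have [d01 e01] := is_derive_add (dMn 0) (dMn 1).
have [d012 e012] := is_derive_add d01 (dMn 2).
have [d03 e03] := is_derive_add d012 (dMn 3).
have -> : (fun q => dot (x q) (y q)) =
    (fun q => coord4 (x q) 0 * coord4 (y q) 0 + coord4 (x q) 1 * coord4 (y q) 1
    + coord4 (x q) 2 * coord4 (y q) 2 + coord4 (x q) 3 * coord4 (y q) 3).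
  by apply/funext => q; rewrite dot_coord4.
split; first exact: d03.
rewrite e03 e012 e01.
have eM n := @derive_val _ _ _ _ _ _ _ (dM n); rewrite !eM.
rewrite !dot_coord4 !(derive_coord4 _ dx) !(derive_coord4 _ dy).
move: ('D_d _ _) ('D_d _ _) ('D_d _ _) ('D_d _ _) => *.
by move: ('D_d _ _) ('D_d _ _) ('D_d _ _) ('D_d _ _) => *; ring.
Qed.

Lemma is_derive_scale h x p d : derivable h p d -> derivable x p d ->
  is_derive p d (fun q => h q *: x q) ('D_d h p *: x p + h p *: 'D_d x p).
Proof.
move=> dh dx.
have dM n := is_derive_mul dh ((derivable_coord4 x p d).1 dx n).
have dhx : derivable (fun q => h q *: x q) p d.
  apply/derivable_coord4 => n.
  rewrite (_ : (fun q => _) = (fun q => h q * coord4 (x q) n)); last first.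
    by apply/funext => q; rewrite coord4Z.
  by have [] := dM n.
split=> //; apply: coord4P => n _; rewrite derive_coord4//.
rewrite (_ : (fun q => _) = (fun q => h q * coord4 (x q) n)); last first.
  by apply/funext => q; rewrite coord4Z.
have [_ ->] := dM n.
by rewrite coord4D !coord4Z derive_coord4// addrC [_ * coord4 _ _]mulrC.
Qed.

Lemma pu_pv_vector U x p : open U -> smooth 2 U x -> U p ->
  pu (pv x) p = pv (pu x) p.
Proof.
move=> oU sx Up; apply: coord4P => n _.
have [dvx _] := smooth_derivable (smooth_pv oU sx) Up.
have [_ dux] := smooth_derivable (smooth_pu oU sx) Up.
(* Exchanging coordinate and first derivative must hold on all of U, because the result is
   differentiated once more. *)
have eu := eq_pu oU (fun q Uq => derive_coord4 n (smooth_derivable sx Uq).2) Up.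
have ev := eq_pv oU (fun q Uq => derive_coord4 n (smooth_derivable sx Uq).1) Up.
apply: etrans (etrans (derive_coord4 n dvx) eu) _.
apply: etrans (pu_pv oU (sx n) Up) _.
exact: esym (etrans (derive_coord4 n dux) ev).
Qed.

End VectorCalculus.

(** * Soliton surface of an abstract frame *)

(** The purely algebraic end of the computation, where each letter is a value at one point: g, g'
    and g'' are the first three derivatives of k ^+ 2, and a, b the components of N_v. The leading
    factors 2 anticipate the one half in the mean curvature vector. *)
Lemma soliton_coefficients (F : numFieldType)
    (k k_u k_uu k_uuu s s_u t t_u t_uu t_uuu : F)
    (f f_u f_uu f_uuu fs_u g g' g'' a b a_u : F) :
  k != 0 -> t != 0 ->
  f = k * k * t ->
  g = k * k_u + k * k_u ->
  g' = k * k_uu + k_u * k_u + (k * k_uu + k_u * k_u) ->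
  g'' = 2 * (k * k_uuu + 3 * (k_u * k_uu)) ->
  f_u = k * k * t_u + t * g ->
  f_uu = k * k * t_uu + t_u * g + (t * g' + g * t_u) ->
  f_uuu = k * k * t_uuu + 3 * (g * t_uu) + 3 * (g' * t_u) + t * g'' ->
  fs_u = f * s_u + s * f_u ->
  a = (f_uu - f * (s * s)) / k ->
  b = - (f_u * s + fs_u) / k ->
  a_u = (f_uuu - (f * (2 * s * s_u) + s * s * f_u)) / k
        - (f_uu - f * (s * s)) * k_u / k ^+ 2 ->
  let B := - 3 * k ^+ 3 * t * s * s_u + k ^+ 5 * t_u + 2 * k ^+ 4 * t * k_u
           - 2 * t * k_u ^+ 3
           - k ^+ 2 * s ^+ 2 * (3 * k * t_u + 5 * t * k_u)
           + 2 * k * k_u * (k_u * t_u + 2 * t * k_uu)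
           + k ^+ 3 * t_uuu
           + k ^+ 2 * (5 * k_u * t_uu + 6 * t_u * k_uu + 2 * t * k_uuu) in
  let C := k ^+ 2 * s ^+ 2 * t - k * (4 * k_u * t_u + k * t_uu)
           + t * (k ^+ 4 - 2 * k_u ^+ 2 - 2 * k * k_uu) in
  (k * f_u + a_u + b * s) / (t * f) = 2 * ((2 * (k ^+ 2 * t) ^+ 2)^-1 * B) /\
  k - a / f = 2 * ((2 * (k ^+ 2 * t) ^+ 2)^-1 * (k * t * C)).
Proof.
move=> k0 t0 -> -> -> -> -> -> -> -> -> -> ->.
by split; field; rewrite k0 t0.
Qed.

(** * Leibniz rules for scalar and vector fields *)

Section DerivativeRules.
Context {R : realType}.
Variables (U : set (R * R)) (p : R * R).
Hypothesis Up : U p.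
Implicit Types (f g : R * R -> R) (x y : R * R -> 'rV[R]_4).

Lemma puD f g : Ck 1 U f -> Ck 1 U g ->
  pu (fun q => f q + g q) p = pu f p + pu g p.
Proof.
move=> Cf Cg.
have [_ e] := is_derive_add (Ck_derivable Cf Up).1 (Ck_derivable Cg Up).1.
exact: e.
Qed.

Lemma puN f : Ck 1 U f -> pu (fun q => - f q) p = - pu f p.
Proof. by move=> Cf; exact: (deriveN (Ck_derivable Cf Up).1). Qed.

Lemma puM f g : Ck 1 U f -> Ck 1 U g ->
  pu (fun q => f q * g q) p = f p * pu g p + g p * pu f p.
Proof.
move=> Cf Cg.
have [_ e] := is_derive_mul (Ck_derivable Cf Up).1 (Ck_derivable Cg Up).1.
exact: e.
Qed.

Lemma puV f : f p != 0 -> Ck 1 U f ->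
  pu (fun q => (f q)^-1) p = - ((f p)^-1 * (f p)^-1) * pu f p.
Proof.
move=> f0 Cf; have [_ e] := is_derive_inv f0 (Ck_derivable Cf Up).1.
exact: e.
Qed.

Lemma pu_dot x y : smooth 1 U x -> smooth 1 U y ->
  pu (fun q => dot (x q) (y q)) p = dot (pu x p) (y p) + dot (x p) (pu y p).
Proof.
move=> sx sy.
have [_ e] := is_derive_dot (smooth_derivable sx Up).1 (smooth_derivable sy Up).1.
exact: e.
Qed.

Lemma pv_dot x y : smooth 1 U x -> smooth 1 U y ->
  pv (fun q => dot (x q) (y q)) p = dot (pv x p) (y p) + dot (x p) (pv y p).
Proof.
move=> sx sy.
have [_ e] := is_derive_dot (smooth_derivable sx Up).2 (smooth_derivable sy Up).2.
exact: e.
Qed.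

Lemma puZ f x : Ck 1 U f -> smooth 1 U x ->
  pu (fun q => f q *: x q) p = pu f p *: x p + f p *: pu x p.
Proof.
move=> Cf sx.
have [_ e] := is_derive_scale (Ck_derivable Cf Up).1 (smooth_derivable sx Up).1.
exact: e.
Qed.

Lemma pvZ f x : Ck 1 U f -> smooth 1 U x ->
  pv (fun q => f q *: x q) p = pv f p *: x p + f p *: pv x p.
Proof.
move=> Cf sx.
have [_ e] := is_derive_scale (Ck_derivable Cf Up).2 (smooth_derivable sx Up).2.
exact: e.
Qed.

Lemma pu_combination f x g y :
  Ck 1 U f -> smooth 1 U x -> Ck 1 U g -> smooth 1 U y ->
  pu (fun q => f q *: x q + g q *: y q) p =
    (pu f p *: x p + f p *: pu x p) + (pu g p *: y p + g p *: pu y p).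
Proof.
move=> Cf sx Cg sy.
have [dfx efx] := is_derive_scale (Ck_derivable Cf Up).1 (smooth_derivable sx Up).1.
have [dgy egy] := is_derive_scale (Ck_derivable Cg Up).1 (smooth_derivable sy Up).1.
apply: etrans (deriveD dfx dgy) _; rewrite efx egy; exact: erefl.
Qed.

Lemma pv_combination f x g y :
  Ck 1 U f -> smooth 1 U x -> Ck 1 U g -> smooth 1 U y ->
  pv (fun q => f q *: x q + g q *: y q) p =
    (pv f p *: x p + f p *: pv x p) + (pv g p *: y p + g p *: pv y p).
Proof.
move=> Cf sx Cg sy.
have [dfx efx] := is_derive_scale (Ck_derivable Cf Up).2 (smooth_derivable sx Up).2.
have [dgy egy] := is_derive_scale (Ck_derivable Cg Up).2 (smooth_derivable sy Up).2.
apply: etrans (deriveD dfx dgy) _; rewrite efx egy; exact: erefl.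
Qed.

End DerivativeRules.

Section PartialsOfConstants.
Context {R : realType}.
Variables (U : set (R * R)) (p : R * R).
Hypotheses (U_open : open U) (Up : U p).
Implicit Types (x y : R * R -> 'rV[R]_4).

(** Moves a derivative from one frame vector to another; the frame equations rest on this
    exchange. *)
Lemma pu_dot_cst (c : R) x y : smooth 1 U x -> smooth 1 U y ->
  (forall q, U q -> dot (x q) (y q) = c) ->
  dot (pu x p) (y p) = - dot (x p) (pu y p).
Proof.
move=> sx sy xy; apply/eqP; rewrite -addr_eq0; apply/eqP.
rewrite -(pu_dot Up sx sy) (eq_pu (g := fun=> c) U_open xy Up).
exact: derive_cst.
Qed.

Lemma pv_dot_cst (c : R) x y : smooth 1 U x -> smooth 1 U y ->
  (forall q, U q -> dot (x q) (y q) = c) ->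
  dot (pv x p) (y p) = - dot (x p) (pv y p).
Proof.
move=> sx sy xy; apply/eqP; rewrite -addr_eq0; apply/eqP.
rewrite -(pv_dot Up sx sy) (eq_pv (g := fun=> c) U_open xy Up).
exact: derive_cst.
Qed.

Lemma dot_pu_self (c : R) x : smooth 1 U x ->
  (forall q, U q -> dot (x q) (x q) = c) -> dot (pu x p) (x p) = 0.
Proof.
move=> sx xx; have := pu_dot_cst sx sx xx.
by rewrite [dot (x p) _]dotC; lra.
Qed.

Lemma dot_pv_self (c : R) x : smooth 1 U x ->
  (forall q, U q -> dot (x q) (x q) = c) -> dot (pv x p) (x p) = 0.
Proof.
move=> sx xx; have := pv_dot_cst sx sx xx.
by rewrite [dot (x p) _]dotC; lra.
Qed.

End PartialsOfConstants.

(** * Evolution of the frame in v and the mean curvature vector *)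

Section SolitonSurface.
(* Otherwise unification unfolds the limits behind the partial derivatives. *)
Local Opaque pu pv dot shape_operator.
Context {R : realType}.
Variables (U : set (R * R)) (Omega T E D N : R * R -> 'rV[R]_4)
  (k s t : R * R -> R).
Hypotheses (U_open : open U) (Omega_smooth : smooth 3 U Omega)
  (E_smooth : smooth 3 U E) (D_smooth : smooth 3 U D) (N_smooth : smooth 2 U N)
  (k_smooth : Ck 4 U k) (s_smooth : Ck 2 U s) (t_smooth : Ck 3 U t).
Hypotheses (k_neq0 : forall q, U q -> k q != 0)
  (t_neq0 : forall q, U q -> t q != 0).
Hypotheses (TT : forall q, U q -> dot (T q) (T q) = 1)
  (DD : forall q, U q -> dot (D q) (D q) = 1)
  (NN : forall q, U q -> dot (N q) (N q) = 1)
  (ET : forall q, U q -> dot (E q) (T q) = 0)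
  (DT : forall q, U q -> dot (D q) (T q) = 0)
  (NT : forall q, U q -> dot (N q) (T q) = 0)
  (DE : forall q, U q -> dot (D q) (E q) = 0)
  (NE : forall q, U q -> dot (N q) (E q) = 0)
  (ND : forall q, U q -> dot (N q) (D q) = 0).
Let f q := k q * k q * t q.
Hypotheses (puOmega : pu Omega = T)
  (pvOmega : forall q, U q -> pv Omega q = f q *: D q)
  (puT : forall q, U q -> pu T q = k q *: N q)
  (pu_frameN : forall q, U q -> pu N q = (- k q) *: T q + (- t q) *: E q)
  (puE : forall q, U q -> pu E q = s q *: D q + t q *: N q)
  (pu_frameD : forall q, U q -> pu D q = (- s q) *: E q).

Let k3 : Ck 3 U k := CkW (isT : (3 <= 4)%N) k_smooth.
Let k1 : Ck 1 U k := CkW (isT : (1 <= 4)%N) k_smooth.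
Let t1 : Ck 1 U t := CkW (isT : (1 <= 3)%N) t_smooth.
Let s1 : Ck 1 U s := CkW (isT : (1 <= 2)%N) s_smooth.
Let E1 : smooth 1 U E := smoothW (isT : (1 <= 3)%N) E_smooth.
Let D1 : smooth 1 U D := smoothW (isT : (1 <= 3)%N) D_smooth.
Let N1 : smooth 1 U N := smoothW (isT : (1 <= 2)%N) N_smooth.
Let f_smooth : Ck 3 U f := CkM U_open (CkM U_open k3 k3) t_smooth.
Let f1 : Ck 1 U f := CkW (isT : (1 <= 3)%N) f_smooth.
Let fu1 : Ck 1 U (pu f) := CkW (isT : (1 <= 2)%N) (Ck_pu f_smooth).

Let T_smooth : smooth 2 U T.
Proof. rewrite -puOmega; exact: smooth_pu. Qed.

Let T1 : smooth 1 U T := smoothW (isT : (1 <= 2)%N) T_smooth.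

Let fs q := f q * s q.

Let fs_smooth : Ck 2 U fs :=
  CkM U_open (CkW (isT : (2 <= 3)%N) f_smooth) s_smooth.
Let fs1 : Ck 1 U fs := CkW (isT : (1 <= 2)%N) fs_smooth.

Let a q := (pu (pu f) q - f q * (s q * s q)) * (k q)^-1.

Let b q := - (pu f q * s q + pu fs q) * (k q)^-1.

Let kV1 : Ck 1 U (fun q => (k q)^-1) := CkV U_open k_neq0 k1.

Let a_num1 : Ck 1 U (fun q => pu (pu f) q - f q * (s q * s q)) :=
  CkB U_open (Ck_pu (Ck_pu f_smooth)) (CkM U_open f1 (CkM U_open s1 s1)).

Let a1 : Ck 1 U a := CkM U_open a_num1 kV1.

Let b1 : Ck 1 U b :=
  CkM U_open (CkN U_open (CkD U_open (CkM U_open fu1 s1) (Ck_pu fs_smooth))) kV1.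

Lemma pv_T q : U q -> pv T q = pu f q *: D q + (- fs q) *: E q.
Proof.
have Omega2 : smooth 2 U Omega := smoothW (isT : (2 <= 3)%N) Omega_smooth.
move=> Uq; rewrite -puOmega -(pu_pv_vector U_open Omega2 Uq).
rewrite (eq_pu U_open pvOmega Uq) (puZ Uq f1 D1) (pu_frameD Uq) scalerA mulrN.
by [].
Qed.

Lemma pv_kN q : U q -> pv k q *: N q + k q *: pv N q =
  (pu (pu f) q - f q * (s q * s q)) *: D q
  + ((- (pu f q * s q + pu fs q)) *: E q + (- (fs q * t q)) *: N q).
Proof.
move=> Uq.
rewrite -(pvZ Uq k1 N1).
rewrite -(eq_pv U_open puT Uq) -(pu_pv_vector U_open T_smooth Uq).
rewrite (eq_pu U_open pv_T Uq).
rewrite (pu_combination Uq fu1 D1 (CkN U_open fs1) E1) (puN Uq fs1).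
rewrite (pu_frameD Uq) (puE Uq).
rewrite /fs; apply: coord4P => n _; rewrite !(coord4D, coord4Z).
by move: (pu _ _) (pu _ _) (pu _ _) => *; ring.
Qed.

Lemma pv_N q : U q -> pv N q = a q *: D q + b q *: E q.
Proof.
move=> Uq; have kN := pv_kN Uq.
have NvN : dot (pv N q) (N q) = 0.
  exact: (dot_pv_self U_open Uq N1 NN).
(* N_v is orthogonal to the unit field N, so the N-component of [pv_kN] is the evolution law of k;
   removing it leaves k N_v alone. *)
have k_v : pv k q = - (fs q * t q).
  have := congr1 (fun x => dot x (N q)) kN.
  rewrite !dotE NvN (NN Uq) [dot (D q) _]dotC (ND Uq) [dot (E q) _]dotC (NE Uq).
  by rewrite !mulr0 !mulr1 !addr0 !add0r.
have kN' : k q *: pv N q = (pu (pu f) q - f q * (s q * s q)) *: D q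
    + (- (pu f q * s q + pu fs q)) *: E q.
  by move: kN; rewrite k_v addrA [RHS]addrC => /addrI.
rewrite /a /b ![_ * (k q)^-1]mulrC -!scalerA -scalerDr -kN' scalerA.
by rewrite (mulVf (k_neq0 Uq)) scale1r.
Qed.

Lemma dot_pvE_D q : U q ->
  t q * dot (pv E q) (D q) = - (k q * pu f q + pu a q + b q * s q).
Proof.
move=> Uq.
have := pu_pv_vector U_open N_smooth Uq.
rewrite (eq_pu U_open pv_N Uq) (eq_pv U_open pu_frameN Uq).
rewrite (pu_combination Uq a1 D1 b1 E1) (pu_frameD Uq) (puE Uq).
rewrite (pv_combination Uq (CkN U_open k1) T1 (CkN U_open t1) E1) (pv_T Uq).
(* Pairing with D removes the terms in k_v, t_v and b_u, which multiply T, E and E. *)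
move=> /(congr1 (fun x => dot x (D q))).
rewrite !dotE (DD Uq) [dot (T q) _]dotC (DT Uq) [dot (E q) _]dotC (DE Uq) (ND Uq).
by move: (dot _ _) (pu _ _) (pu _ _) (pv _ _) (pu _ _) (pv _ _) => *; lra.
Qed.

Lemma mean_curvature_soliton q : U q ->
  mean_curvature_vector Omega E N q =
    2^-1 *: (((k q * pu f q + pu a q + b q * s q) / (t q * f q)) *: E q
             + (k q - a q / f q) *: N q).
Proof.
move=> Uq.
have f0 : f q != 0 by rewrite !mulf_neq0 ?k_neq0 ?t_neq0.
(* One factor f of Omega_v = f D cancels against the entry f * f of the first form. *)
have tr xi : \tr (shape_operator Omega xi q) =
    - (dot (pu xi q) (T q) + dot (pv xi q) (D q) / f q).
  have ff0 : f q * f q != 0 by exact: mulf_neq0.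
  have uu : dot (pu Omega q) (pu Omega q) = 1 by rewrite puOmega (TT Uq).
  have vv : dot (pv Omega q) (pv Omega q) = f q * f q.
    by rewrite (pvOmega Uq) dotZl dotZr (DD Uq) mulr1.
  have uv : dot (pu Omega q) (pv Omega q) = 0.
    by rewrite puOmega (pvOmega Uq) dotZr dotC (DT Uq) mulr0.
  apply: etrans (orthogonal_trace_shape xi uu vv (oner_neq0 _) ff0 uv) _.
  have uxi : dot (pu xi q) (pu Omega q) = dot (pu xi q) (T q).
    by rewrite puOmega.
  have vxi : dot (pv xi q) (pv Omega q) = f q * dot (pv xi q) (D q).
    by rewrite (pvOmega Uq) dotZr.
  apply: etrans (congr2 (fun u v => - (u / 1 + v / (f q * f q))) uxi vxi) _.
  move: (dot _ _) (dot _ _) (f q) f0 => x y f' f0'.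
  by rewrite /= divr1 invfM mulrA [f' * _]mulrC mulfK.
(* The compatibility condition determines t <E_v, D>; dividing by t produces the denominator t f. *)
have h := dot_pvE_D Uq.
have trE : \tr (shape_operator Omega E q) =
    (k q * pu f q + pu a q + b q * s q) / (t q * f q).
  apply: etrans (tr E) _.
  rewrite (puE Uq) !dotE (DT Uq) (NT Uq).
  have t0 := t_neq0 Uq; move: h.
  move: (k q * pu f q + pu a q + b q * s q) (dot _ _) => X d h.
  have -> : X = - (t q * d) by rewrite h opprK.
  by move: (f q) f0 (t q) t0 (s q) => f' f0' t' t0' s'; field; rewrite f0' t0'.
have trN : \tr (shape_operator Omega N q) = k q - a q / f q.
  apply: etrans (tr N) _.
  rewrite (pu_frameN Uq) (pv_N Uq) !dotE (TT Uq) (ET Uq) (DD Uq).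
  rewrite (dotC (E q) (D q)) (DE Uq).
  by rewrite !mulr1 !mulr0 !addr0 opprD opprK.
exact: mean_curvature_vector_trace trE trN.
Qed.

(** Each factor must be C^1 before a rule for [pu] applies. With t of class C^3, its second
    derivative has exactly the order left for the term t_uuu. *)
Let ku1 : Ck 1 U (pu k) := CkW (isT : (1 <= 3)%N) (Ck_pu k_smooth).
Let kuu1 : Ck 1 U (pu (pu k)) := CkW (isT : (1 <= 2)%N) (Ck_pu (Ck_pu k_smooth)).
Let tu1 : Ck 1 U (pu t) := CkW (isT : (1 <= 2)%N) (Ck_pu t_smooth).
Let tuu1 : Ck 1 U (pu (pu t)) := Ck_pu (Ck_pu t_smooth).
Let kk1 : Ck 1 U (fun q => k q * k q) := CkM U_open k1 k1.

(* The first two derivatives of [k ^+ 2]. *)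
Let g q := k q * pu k q + k q * pu k q.
Let g' q := k q * pu (pu k) q + pu k q * pu k q
  + (k q * pu (pu k) q + pu k q * pu k q).

Let kku1 : Ck 1 U (fun q => k q * pu k q) := CkM U_open k1 ku1.
Let kkuu1 : Ck 1 U (fun q => k q * pu (pu k) q) := CkM U_open k1 kuu1.
Let kuku1 : Ck 1 U (fun q => pu k q * pu k q) := CkM U_open ku1 ku1.
Let g1 : Ck 1 U g := CkD U_open kku1 kku1.
Let g'1 : Ck 1 U g' := CkD U_open (CkD U_open kkuu1 kuku1) (CkD U_open kkuu1 kuku1).

(** [g] and [g'] are spelled in the unsimplified form that the product rule returns, so rewriting
    alone closes the goal. *)
Let pu_g q : U q -> pu g q = g' q.
Proof. by move=> Uq; rewrite (puD Uq kku1 kku1) (puM Uq k1 ku1). Qed.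

Let pu_g' q : U q -> pu g' q =
  2 * (k q * pu (pu (pu k)) q + 3 * (pu k q * pu (pu k) q)).
Proof.
move=> Uq; rewrite (puD Uq (CkD U_open kkuu1 kuku1) (CkD U_open kkuu1 kuku1)).
rewrite (puD Uq kkuu1 kuku1) (puM Uq k1 kuu1) (puM Uq ku1 ku1).
by move: (pu _ _) (pu _ _) (pu _ _) => *; ring.
Qed.

Let pu_f q : U q -> pu f q = k q * k q * pu t q + t q * g q.
Proof. by move=> Uq; rewrite (puM Uq kk1 t1) (puM Uq k1 k1). Qed.

Let pu_pu_f q : U q ->
  pu (pu f) q = k q * k q * pu (pu t) q + pu t q * g q + (t q * g' q + g q * pu t q).
Proof.
move=> Uq; apply: etrans (eq_pu U_open pu_f Uq) _.
rewrite (puD Uq (CkM U_open kk1 tu1) (CkM U_open t1 g1)).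
by rewrite (puM Uq kk1 tu1) (puM Uq t1 g1) (pu_g Uq) (puM Uq k1 k1).
Qed.

Let pu_pu_pu_f q : U q ->
  pu (pu (pu f)) q = k q * k q * pu (pu (pu t)) q + 3 * (g q * pu (pu t) q)
    + 3 * (g' q * pu t q) + t q * pu g' q.
Proof.
move=> Uq; apply: etrans (eq_pu U_open pu_pu_f Uq) _.
rewrite (puD Uq (CkD U_open (CkM U_open kk1 tuu1) (CkM U_open tu1 g1))
  (CkD U_open (CkM U_open t1 g'1) (CkM U_open g1 tu1))).
rewrite (puD Uq (CkM U_open kk1 tuu1) (CkM U_open tu1 g1)).
rewrite (puD Uq (CkM U_open t1 g'1) (CkM U_open g1 tu1)).
rewrite (puM Uq kk1 tuu1) (puM Uq tu1 g1) (puM Uq t1 g'1) (puM Uq g1 tu1).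
rewrite (pu_g Uq) (puM Uq k1 k1) -/(g q).
by move: (pu _ _) (pu _ _) (pu _ _) (pu _ _) (g q) (g' q) => *; ring.
Qed.

Let pu_a q : U q ->
  pu a q = (pu (pu (pu f)) q - (f q * (2 * s q * pu s q) + s q * s q * pu f q)) / k q
    - (pu (pu f) q - f q * (s q * s q)) * pu k q / k q ^+ 2.
Proof.
move=> Uq; rewrite (puM Uq a_num1 kV1) (puV Uq (k_neq0 Uq) k1).
have fss1 := CkM U_open f1 (CkM U_open s1 s1).
rewrite (puD Uq (Ck_pu (Ck_pu f_smooth)) (CkN U_open fss1)) (puN Uq fss1).
rewrite (puM Uq f1 (CkM U_open s1 s1)) (puM Uq s1 s1).
have k0 := k_neq0 Uq.
by move: (pu _ _) (pu _ _) (pu _ _) (pu _ _) (f q) (k q) k0 => *; field.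
Qed.

Let pu_fs q : U q -> pu fs q = f q * pu s q + s q * pu f q.
Proof. by move=> Uq; rewrite (puM Uq f1 s1). Qed.

Lemma mean_curvature_soliton_explicit q : U q ->
  let k_u := pu k q in
  let k_uu := pu (pu k) q in
  let k_uuu := pu (pu (pu k)) q in
  let s_u := pu s q in
  let t_u := pu t q in
  let t_uu := pu (pu t) q in
  let t_uuu := pu (pu (pu t)) q in
  let k := k q in let s := s q in let t := t q in
  let B := - 3 * k ^+ 3 * t * s * s_u + k ^+ 5 * t_u + 2 * k ^+ 4 * t * k_u
           - 2 * t * k_u ^+ 3
           - k ^+ 2 * s ^+ 2 * (3 * k * t_u + 5 * t * k_u)
           + 2 * k * k_u * (k_u * t_u + 2 * t * k_uu)
           + k ^+ 3 * t_uuu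
           + k ^+ 2 * (5 * k_u * t_uu + 6 * t_u * k_uu + 2 * t * k_uuu) in
  let C := k ^+ 2 * s ^+ 2 * t - k * (4 * k_u * t_u + k * t_uu)
           + t * (k ^+ 4 - 2 * k_u ^+ 2 - 2 * k * k_uu) in
  mean_curvature_vector Omega E N q =
    (2 * (k ^+ 2 * t) ^+ 2)^-1 *: (B *: E q + (k * t * C) *: N q).
Proof.
move=> Uq.
have [BE CN] := soliton_coefficients (k_neq0 Uq) (t_neq0 Uq) (erefl (f q))
  (erefl (g q)) (erefl (g' q)) (pu_g' Uq) (pu_f Uq) (pu_pu_f Uq) (pu_pu_pu_f Uq)
  (pu_fs Uq) (erefl (a q)) (erefl (b q)) (pu_a Uq).
apply: etrans (mean_curvature_soliton Uq) _.
(* Cancels the one half of the mean curvature vector against the factors 2 from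
   [soliton_coefficients]. *)
have half (m x y : R) (e n : 'rV[R]_4) :
    2^-1 *: ((2 * (m * x)) *: e + (2 * (m * y)) *: n) = m *: (x *: e + y *: n).
  by rewrite -!scalerA -!scalerDr scalerK// pnatr_eq0.
rewrite BE CN; exact: half.
Qed.

End SolitonSurface.

(** * The frame equations *)

Section HypersurfaceNormal.
Context {R : realType}.

(** A local defining function F vanishes along the curve, so by the chain rule its differential
    kills the velocity w; nu is orthogonal to that kernel. *)
Lemma oriented_hypersurface_normal (M : set 'rV[R]_4) nu (c : R -> 'rV[R]_4) w :
  oriented_hypersurface M nu -> is_derive (0 : R) 1 c w ->
  (\forall r \near (0 : R), M (c r)) ->
  dot (nu (c 0)) w = 0 /\ enorm (nu (c 0)) = 1.
Proof.
move=> [_ Mnu] dc Mc.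
have [F [dF _ MF nu1 nuT]] := Mnu _ (nbhs_singleton Mc).
split=> //; apply: nuT.
have [dFc _] := nbhs_singleton dF.
have dcc : differentiable c 0 by apply/derivable1_diffP; case: dc.
have cw : 'd c (0 : R) 1 = w by rewrite -deriveE//; case: dc.
have Fc0 : \forall r \near (0 : R), F (c r) = 0.
  (* Continuity of c pulls the local equivalence of M with the zero set of F back to parameters near
     0. *)
  have := differentiable_continuous dcc; move=> /(_ _ MF) MF'.
  by apply: filterS2 Mc MF' => r Mr [Mc0 _]; exact: Mc0.
have : 'D_1 (F \o c) (0 : R) = 0.
  by rewrite (near_eq_derive (g := fun=> 0))// derive_cst.
rewrite deriveE; last exact: differentiable_comp.
by rewrite diff_comp// /= cw.
Qed.

Lemma is_derive_pu U (x : R * R -> 'rV[R]_4) p : smooth 1 U x -> U p ->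
  is_derive p (1, 0) x (pu x p).
Proof. by move=> sx Up; apply: derivableP; exact: (smooth_derivable sx Up).1. Qed.

(** If the part w of z orthogonal to x were nonzero, pairing a linear relation with w, x and y in
    turn would make all its coefficients vanish. *)
Lemma orthonormal_dependent (x y z : 'rV[R]_4) :
  dot x x = 1 -> dot y y = 1 -> dot x y = 0 -> dot z y = 0 ->
  ~~ free [:: x; y; z] -> z = dot z x *: x.
Proof.
move=> xx yy xy zy; apply: contraNeq; rewrite -subr_eq0 => w0; apply/freeP => c.
rewrite !big_ord_recl big_ord0 /= addr0.
set c0 := c ord0; set c1 := c (lift ord0 ord0).
set c2 := c (lift ord0 (lift ord0 ord0)).
move=> cxyz.
have dotc v : c0 * dot x v + (c1 * dot y v + c2 * dot z v) = 0.
  by rewrite -!dotZl -!dotDl cxyz dot0l.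
have c2_0 : c2 = 0.
  set w := z - _ in w0.
  have xw : dot x w = 0 by rewrite dotDr dotNr dotZr xx (dotC x z) mulr1 subrr.
  have yw : dot y w = 0.
    by rewrite dotDr dotNr dotZr (dotC y z) zy (dotC y x) xy mulr0 subrr.
  have zw : dot z w = dot w w by rewrite {2}/w dotDl dotNl dotZl xw mulr0 subr0.
  have := dotc w; rewrite xw yw zw !mulr0 !add0r => /eqP.
  by rewrite mulf_eq0 dot_eq0 (negPf w0) orbF => /eqP.
have c0_0 : c0 = 0.
  by have := dotc x; rewrite xx (dotC y) xy c2_0 mulr0 mul0r !addr0 mulr1.
have c1_0 : c1 = 0.
  by have := dotc y; rewrite yy xy zy !mulr0 addr0 add0r mulr1.
case=> -[|[|[|//]]] i3.
- by rewrite -[RHS]c0_0; congr c; exact: val_inj.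
- by rewrite -[RHS]c1_0; congr c; exact: val_inj.
- by rewrite -[RHS]c2_0; congr c; exact: val_inj.
Qed.

End HypersurfaceNormal.

(** * Regularity, orthonormality and derivatives of the frame in u *)

Section FrameEquations.
Local Opaque pu pv dot vprod coord4.
Context {R : realType}.
Variables (U : set (R * R)) (Omega N : R * R -> 'rV[R]_4).
Hypotheses (U_open : open U) (Omega_smooth : smooth 6 U Omega)
  (N_smooth : smooth 4 U N) (frame : ED2_frame_field Omega N U)
  (kappa_neq0 : forall p, U p -> kappa Omega N p != 0).
Let T := frameT Omega.
Let E := frameE Omega N.
Let D := frameD Omega N.
Let k := kappa Omega N.
Let s := sigma Omega N.
Let t := tau Omega N.

Let T_smooth : smooth 5 U T := smooth_pu U_open Omega_smooth.
Let T1 : smooth 1 U T := smoothW (isT : (1 <= 5)%N) T_smooth.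
Let N1 : smooth 1 U N := smoothW (isT : (1 <= 4)%N) N_smooth.

Lemma Ck_kappa : Ck 4 U k.
Proof. exact: Ck_dot U_open (smooth_pu U_open T_smooth) N_smooth. Qed.

Let k1 : Ck 1 U k := CkW (isT : (1 <= 4)%N) Ck_kappa.

Lemma smooth_preE : smooth 3 U (preE Omega N).
Proof.
have N3 : smooth 3 U N := smoothW (isT : (3 <= 4)%N) N_smooth.
have T3 : smooth 3 U T := smoothW (isT : (3 <= 5)%N) T_smooth.
have w3 := smooth_pu U_open (smooth_pu U_open T_smooth).
exact: smoothB U_open (smoothB U_open w3 (smoothZ U_open (Ck_dot U_open w3 N3) N3))
  (smoothZ U_open (Ck_dot U_open w3 T3) T3).
Qed.

Lemma Ck_enorm_preE : Ck 3 U (fun q => enorm (preE Omega N q)).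
Proof.
apply: Ck_sqrt U_open _ (Ck_dot U_open smooth_preE smooth_preE) => q Uq.
rewrite -sqrtr_gt0 [_ < _]enorm_gt0; case: frame => _ _ _; exact.
Qed.

Let e_neq0 q : U q -> enorm (preE Omega N q) != 0.
Proof.
by move=> Uq; rewrite gt_eqF// enorm_gt0; case: frame => _ _ _; apply.
Qed.

Lemma smooth_frameE : smooth 3 U E.
Proof. exact: smoothZ U_open (CkV U_open e_neq0 Ck_enorm_preE) smooth_preE. Qed.

Let E1 : smooth 1 U E := smoothW (isT : (1 <= 3)%N) smooth_frameE.

Lemma smooth_frameD : smooth 3 U D.
Proof.
exact: smooth_vprod U_open (smoothW (isT : (3 <= 4)%N) N_smooth)
  (smoothW (isT : (3 <= 5)%N) T_smooth) smooth_frameE.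
Qed.

Let D1 : smooth 1 U D := smoothW (isT : (1 <= 3)%N) smooth_frameD.

Lemma Ck_sigma : Ck 2 U s.
Proof.
exact: Ck_dot U_open (smooth_pu U_open smooth_frameE)
  (smoothW (isT : (2 <= 3)%N) smooth_frameD).
Qed.

Lemma frame_TT q : U q -> dot (T q) (T q) = 1.
Proof. by case: frame => T1' _ _ _ Uq; apply: enorm1_dot; exact: T1'. Qed.

Lemma frame_N q : U q -> dot (N q) (T q) = 0 /\ dot (N q) (N q) = 1.
Proof.
case: frame => _ hyp _ _ Uq.
have [M [nu [Mnu MN]]] := hyp q.2.
have lineE (r : R) : r *: (1, 0) + q = (r *: 1 + q.1, q.2).
  by case: (q) => u v; congr (_, _); rewrite /= scaler0 add0r.
(* The curve is the u-line through q, on the hypersurface attached to v = q.2; since U is open, the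
   line stays in U for small parameters. *)
have [||nT n1] := oriented_hypersurface_normal (w := T q)
  (c := fun r => Omega (r *: (1, 0) + q)) Mnu.
- apply: (iffLR (is_derive_line Omega q (1, 0) (T q))).
  exact: is_derive_pu (smoothW (isT : (1 <= 6)%N) Omega_smooth) Uq.
- have Ur : \forall r \near (0 : R), U (r *: (1, 0) + q).
    have lc : {for (0 : R), continuous (fun r : R => r *: ((1, 0) : R * R) + q)}.
      by apply: continuousD; [exact: scalel_continuous|exact: cst_continuous].
    apply: lc; rewrite scale0r add0r; exact: open_nbhs_nbhs.
  apply: filterS Ur => r; rewrite lineE => Ur.
  exact: (MN _ Ur).1.
have Nq : N q = nu (Omega q).
  by case: q Uq MN {lineE nT n1} => u v Uq MN; exact: (MN _ Uq).2.
by move: nT n1; rewrite scale0r add0r -Nq => -> /enorm1_dot.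
Qed.

Lemma frame_NT q : U q -> dot (N q) (T q) = 0.
Proof. by case/frame_N. Qed.

Lemma frame_NN q : U q -> dot (N q) (N q) = 1.
Proof. by case/frame_N. Qed.

Let NvN q : U q -> dot (pu N q) (N q) = 0.
Proof. by move=> Uq; exact: (dot_pu_self U_open Uq N1 frame_NN). Qed.

Let TvT q : U q -> dot (pu T q) (T q) = 0.
Proof. by move=> Uq; exact: (dot_pu_self U_open Uq T1 frame_TT). Qed.

Let NvT q : U q -> dot (pu N q) (T q) = - k q.
Proof.
move=> Uq; rewrite (pu_dot_cst U_open Uq N1 T1 frame_NT); congr (- _).
exact: dotC.
Qed.

(** Unit speed makes T_u orthogonal to T, and the assumed dependence of N, T, T_u then leaves only
    the direction of N. *)
Lemma frame_pu_T q : U q -> pu T q = k q *: N q.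
Proof.
move=> Uq; case: frame => _ _ /(_ _ Uq) dep _.
exact: orthonormal_dependent (frame_NN Uq) (frame_TT Uq) (frame_NT Uq) (TvT Uq) dep.
Qed.

Lemma frame_puu_T q : U q -> pu (pu T) q = pu k q *: N q + k q *: pu N q.
Proof.
by move=> Uq; rewrite (eq_pu U_open frame_pu_T Uq) (puZ Uq k1 N1).
Qed.

Let e q := enorm (preE Omega N q).

Lemma preE_normalized q : U q -> preE Omega N q = e q *: E q.
Proof.
by move=> Uq; rewrite /E /frameE /unitize scalerA mulfV ?e_neq0// scale1r.
Qed.

(** In Omega_uuu = k_u N + k N_u the N-part is k_u N and, as <N_u, T> = - k, the T-part is - k^2 T.
    This ties E to N_u. *)
Lemma preE_pu_N q : U q -> preE Omega N q = k q *: pu N q + (k q * k q) *: T q.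
Proof.
move=> Uq; rewrite /preE -/(frameT Omega) -/T (frame_puu_T Uq).
rewrite !(dotDl, dotZl) (NvN Uq) (NvT Uq) (frame_NN Uq) (frame_NT Uq).
move: (pu k q) (k q) (pu N q) (N q) (T q) => c d x y z.
rewrite !mulr0 addr0 add0r mulr1 mulrN scaleNr opprK; congr (_ + _).
by rewrite addrAC subrr add0r.
Qed.

Lemma frame_ET q : U q -> dot (E q) (T q) = 0.
Proof.
move=> Uq; apply: (mulfI (e_neq0 Uq)).
rewrite mulr0 -dotZl -(preE_normalized Uq) (preE_pu_N Uq) dotDl !dotZl.
by rewrite (NvT Uq) (frame_TT Uq) mulr1 mulrN addNr.
Qed.

Lemma frame_NE q : U q -> dot (N q) (E q) = 0.
Proof.
move=> Uq; rewrite dotC; apply: (mulfI (e_neq0 Uq)).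
rewrite mulr0 -dotZl -(preE_normalized Uq) (preE_pu_N Uq) dotDl !dotZl.
by rewrite (NvN Uq) (dotC (T q)) (frame_NT Uq) !mulr0 addr0.
Qed.

Lemma frame_EE q : U q -> dot (E q) (E q) = 1.
Proof.
move=> Uq; have ee0 := mulf_neq0 (e_neq0 Uq) (e_neq0 Uq).
have pp : dot (preE Omega N q) (preE Omega N q) = e q * e q * dot (E q) (E q).
  by rewrite (preE_normalized Uq) dotZl dotZr mulrA.
by apply: (mulfI ee0); rewrite mulr1 -[LHS]pp -enorm_sqr.
Qed.

Lemma frame_ND q : dot (N q) (D q) = 0.
Proof. exact: dot_vprod1. Qed.

Lemma frame_DT q : dot (D q) (T q) = 0.
Proof. rewrite dotC; exact: dot_vprod2. Qed.

Lemma frame_DE q : dot (D q) (E q) = 0.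
Proof. rewrite dotC; exact: dot_vprod3. Qed.

Lemma frame_DD q : U q -> dot (D q) (D q) = 1.
Proof.
move=> Uq; have TE : dot (T q) (E q) = 0 by rewrite dotC frame_ET.
exact: (dot_vprod_orthonormal (frame_NN Uq) (frame_TT Uq) (frame_EE Uq)
  (frame_NT Uq) (frame_NE Uq) TE).
Qed.

Lemma frame_expansion w q : U q -> w = dot w (T q) *: T q + dot w (E q) *: E q
  + dot w (D q) *: D q + dot w (N q) *: N q.
Proof.
move=> Uq; apply: orthonormal_expansion (frame_TT Uq) (frame_EE Uq)
  (frame_DD Uq) (frame_NN Uq) _ _ _ _ _ _; rewrite dotC.
- exact: frame_ET.
- exact: frame_DT.
- exact: frame_NT.
- exact: frame_DE.
- exact: frame_NE.
- exact: frame_ND.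
Qed.

Let EvN q : U q -> dot (pu N q) (E q) = - t q.
Proof.
move=> Uq; rewrite (pu_dot_cst U_open Uq N1 E1 frame_NE); congr (- _).
exact: dotC.
Qed.

(** Pair [preE] = e E with E: the T-term of [preE_pu_N] drops out, and <N_u, E> = - t. *)
Lemma e_kappa_tau q : U q -> e q = - (k q * t q).
Proof.
move=> Uq; rewrite -[LHS]mulr1 -(frame_EE Uq) -dotZl -(preE_normalized Uq).
rewrite (preE_pu_N Uq) dotDl !dotZl (EvN Uq) (dotC (T q)) (frame_ET Uq).
by rewrite mulr0 addr0 mulrN.
Qed.

(** The definition <E_u, N> would give one order less; dividing [e_kappa_tau] by k involves only e
    and k, which are C^3. *)
Lemma Ck_tau : Ck 3 U t.
Proof.
have k3 : Ck 3 U k := CkW (isT : (3 <= 4)%N) Ck_kappa.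
have C3 : Ck 3 U (fun q => - e q * (k q)^-1).
  exact: CkM U_open (CkN U_open Ck_enorm_preE) (CkV U_open kappa_neq0 k3).
apply: eq_Ck U_open _ C3 => q Uq.
by rewrite (e_kappa_tau Uq) opprK mulrAC mulfV ?mul1r//; exact: kappa_neq0.
Qed.

(** Equates the two expressions of [preE], namely k N_u + k^2 T and - k t E, and cancels k. *)
Lemma frame_pu_N q : U q -> pu N q = (- k q) *: T q + (- t q) *: E q.
Proof.
move=> Uq; have /esym := preE_normalized Uq; rewrite (preE_pu_N Uq) (e_kappa_tau Uq).
move: (pu N q) (T q) (E q) (k q) (kappa_neq0 Uq : k q != 0) (t q) => x y z c c0 d cx.
apply: (scalerI c0); rewrite scalerDr !scalerA !mulrN cx.
by rewrite scaleNr addrCA addNr addr0.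
Qed.

(** The T-coefficient is - <E, T_u> = - k <E, N> = 0; the coefficients along D and N are sigma and
    tau by definition. *)
Lemma frame_pu_E q : U q -> pu E q = s q *: D q + t q *: N q.
Proof.
move=> Uq; rewrite {1}(frame_expansion (pu E q) Uq).
have -> : dot (pu E q) (T q) = 0.
  rewrite (pu_dot_cst U_open Uq E1 T1 frame_ET) (frame_pu_T Uq) dotZr.
  by rewrite dotC (frame_NE Uq) mulr0 oppr0.
rewrite (dot_pu_self U_open Uq E1 frame_EE) !scale0r !add0r.
exact: erefl.
Qed.

Lemma frame_pu_D q : U q -> pu D q = (- s q) *: E q.
Proof.
move=> Uq; rewrite {1}(frame_expansion (pu D q) Uq).
rewrite (pu_dot_cst U_open Uq D1 T1 (fun r _ => frame_DT r)) (frame_pu_T Uq) dotZr.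
rewrite (dotC (D q) (N q)) frame_ND mulr0 oppr0.
rewrite (pu_dot_cst U_open Uq D1 E1 (fun r _ => frame_DE r)) (dotC (D q) (pu E q)).
rewrite (dot_pu_self U_open Uq D1 frame_DD).
(* Here <D_u, N> = - <D, N_u>, and N_u lies in the span of T and E. *)
have -> : dot (pu D q) (N q) = 0.
  have DN r : U r -> dot (D r) (N r) = 0 by rewrite dotC frame_ND.
  rewrite (pu_dot_cst U_open Uq D1 N1 DN) (frame_pu_N Uq) dotDr.
  rewrite (dotZr (- k q)) (dotZr (- t q)).
  by rewrite frame_DT frame_DE !mulr0 addr0 oppr0.
rewrite !scale0r add0r !addr0; exact: erefl.
Qed.

Lemma frame_pv_Omega q : betchov_da_rios Omega U -> U q ->
  pv Omega q = (k q * k q * t q) *: D q.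
Proof.
move=> evol Uq; rewrite (evol _ Uq) -/(frameT Omega) -/T (frame_puu_T Uq).
rewrite (frame_pu_T Uq) (frame_pu_N Uq).
(* The coefficients are those of T_u = k N and Omega_uuu = k_u N + k (- k T - t E). *)
rewrite (vprod_triangular (k q) (pu k q) (k q) (- k q) (- t q)).
by congr (_ *: _); ring.
Qed.

End FrameEquations.

(* C^6 and C^4 are the orders for which every derivative in B exists:
   kappa has order 2 and tau order 3 in Omega. *)
Theorem theorem5 (R : realType) (U : set (R * R))
    (Omega N : R * R -> 'rV[R]_4)
    (U_open : open U)
    (Omega_smooth : Ck 6 U Omega)
    (N_smooth : Ck 4 U N)
    (frame : ED2_frame_field Omega N U)
    (kappa_neq0 : forall p, U p -> kappa Omega N p != 0)
    (tau_neq0 : forall p, U p -> tau Omega N p != 0)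
    (evolution : betchov_da_rios Omega U)
    (p : R * R) (Up : U p) :
  let k := kappa Omega N p in
  let k_u := pu (kappa Omega N) p in
  let k_uu := pu (pu (kappa Omega N)) p in
  let k_uuu := pu (pu (pu (kappa Omega N))) p in
  let s := sigma Omega N p in
  let s_u := pu (sigma Omega N) p in
  let t := tau Omega N p in
  let t_u := pu (tau Omega N) p in
  let t_uu := pu (pu (tau Omega N)) p in
  let t_uuu := pu (pu (pu (tau Omega N))) p in
  let B := - 3 * k ^+ 3 * t * s * s_u + k ^+ 5 * t_u + 2 * k ^+ 4 * t * k_u
           - 2 * t * k_u ^+ 3
           - k ^+ 2 * s ^+ 2 * (3 * k * t_u + 5 * t * k_u)
           + 2 * k * k_u * (k_u * t_u + 2 * t * k_uu)
           + k ^+ 3 * t_uuu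
           + k ^+ 2 * (5 * k_u * t_uu + 6 * t_u * k_uu + 2 * t * k_uuu) in
  let C := k ^+ 2 * s ^+ 2 * t - k * (4 * k_u * t_u + k * t_uu)
           + t * (k ^+ 4 - 2 * k_u ^+ 2 - 2 * k * k_uu) in
  mean_curvature_vector Omega (frameE Omega N) N p =
    (2 * (k ^+ 2 * t) ^+ 2)^-1 *:
      (B *: frameE Omega N p + (k * t * C) *: N p).
Proof.
have sO := Ck_smooth U_open Omega_smooth.
have sN := Ck_smooth U_open N_smooth.
exact: (mean_curvature_soliton_explicit U_open
  (smoothW (isT : (3 <= 6)%N) sO)
  (smooth_frameE U_open sO sN frame) (smooth_frameD U_open sO sN frame)
  (smoothW (isT : (2 <= 4)%N) sN)
  (Ck_kappa U_open sO sN) (Ck_sigma U_open sO sN frame)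
  (Ck_tau U_open sO sN frame kappa_neq0) kappa_neq0 tau_neq0
  (frame_TT frame) (frame_DD U_open sO sN frame) (frame_NN U_open sO frame)
  (frame_ET U_open sO sN frame) (fun q _ => frame_DT Omega N q)
  (frame_NT U_open sO frame) (fun q _ => frame_DE Omega N q)
  (frame_NE U_open sO sN frame) (fun q _ => frame_ND Omega N q) erefl
  (fun q => frame_pv_Omega U_open sO sN frame kappa_neq0 evolution)
  (frame_pu_T U_open sO frame) (frame_pu_N U_open sO sN frame kappa_neq0)
  (frame_pu_E U_open sO sN frame)
  (frame_pu_D U_open sO sN frame kappa_neq0) Up).
Qed.
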